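(* Let $C$ be a smooth projective curve of genus $g\ge2$ over an algebraically closed field $k$, and let $p_1,\ldots,p_g\in C$ be distinct points such that $h^0(p_1+\cdots+p_g)=1$. For each $i$, the components of the tangent map $\delta'_{p_i}: T_{p_i}\to T_{p_i}^*\otimes H^1(C,\mathcal O)/\langle\xi_{p_i}\rangle$ at $p_i$ to the canonical morphism $\varphi_{\omega_C}:C\to\mathbb P(H^0(C,\omega_C)^* )$, with respect to the decomposition $H^1(C,\mathcal O)\simeq\bigoplus_j T_{p_j}$ (so that $H^1(C,\mathcal O)/\langle \xi_{p_i}\rangle\simeq\bigoplus_{j\ne i}T_{p_j}$), are given by tensoring with $-\alpha_{ij}\in T_{p_i}^{-2}\otimes T_{p_j}$, $j\ne i$.
   Context: $T_p$ denotes the tangent line to $C$ at $p$; powers denote tensor powers. Notation: $D=p_1+\cdots+p_g$. For $p\in C$, the connecting homomorphism of $0\to\mathcal O\to\mathcal O(p)\to\mathcal O(p)/\mathcal O\to0$ is a map $T_p\simeq H^0(\mathcal O(p)/\mathcal O)\to H^1(C,\mathcal O)$; $\xi_p$ denotes the image of a generator. The sum of these maps for $p=p_1,\ldots,p_g$ is, because $h^0(D)=1$, an isomorphism $\bigoplus_jT_{p_j}\simeq H^0(\mathcal O(D)/\mathcal O)\to H^1(C,\mathcal O)$. The morphism $\varphi_{\omega_C}$ is given by the linear system $|\omega_C|$, where $\mathbb P(V)$ is the space of lines in $V$; it sends $p$ to the line spanned by the evaluation functional $\mathrm{ev}_p\in\omega_C|_p\otimes H^0(C,\omega_C)^*$.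 Its tangent map at $p$ is the map $T_p\to\omega_C|_p\otimes H^0(C,\omega_C)^*/\langle \mathrm{ev}_p\rangle\simeq\omega_C|_p\otimes H^0(C,\omega_C(-p))^*$, dual to the evaluation $H^0(C,\omega_C(-p))\to\omega_C(-p)|_p\simeq T_p^*\otimes\omega_C|_p$. Under Serre duality $H^0(C,\omega_C)^*\simeq H^1(C,\mathcal O)$, $\mathrm{ev}_p$ corresponds to $\xi_p$, and the tangent map is identified with the connecting homomorphism $$\delta'_p:T_p\simeq T_p^*\otimes H^0(C,\mathcal O(2p)/\mathcal O(p))\to T_p^*\otimes H^1(C,\mathcal O(p))\simeq T_p^*\otimes H^1(C,\mathcal O)/\langle\xi_p\rangle .$$ For $i\neq j$ let $r_i: H^0(C,\mathcal O(D+p_i))/H^0(C,\mathcal O)\to H^0(C,\mathcal O(2p_i)/\mathcal O(p_i))\simeq T_{p_i}^{2}$ (an isomorphism) and $r_{ij}: H^0(C,\mathcal O(D+p_i))/H^0(C,\mathcal O)\to H^0(C,\mathcal O(p_j)/\mathcal O)\simeq T_{p_j}$ be the restriction (polar part) maps; $\alpha_{ij}=r_{ij}\circ r_i^{-1}\in\mathrm{Hom}_k(T_{p_i}^{2},T_{p_j})=T_{p_i}^{-2}\otimes T_{p_j}$. *)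

(* Defs.v *)
From HB Require Import structures.
From mathcomp Require Import all_boot all_order all_algebra.
From mathcomp Require Import mpoly.
From mathcomp Require Import boolp classical_sets functions.
Set Implicit Arguments.
Unset Strict Implicit.
Unset Printing Implicit Defensive.
Import Order.TTheory GRing.Theory Num.Theory.
Local Open Scope ring_scope.
Local Open Scope quotient_scope.

#[short(type="fieldAlgType")]
HB.structure Definition FieldAlgebra (k : nzRingType) :=
  {K of GRing.Field K & GRing.ComUnitAlgebra k K}.

Section LinearAlgebra.
Variable k : fieldType.

Record subspace (V : lmodType k) := Subspace {
  subspace_set :> V -> Prop;
  subspace0 : subspace_set 0;
  subspaceP : forall (a : k) u v,
    subspace_set u -> subspace_set v -> subspace_set (a *: u + v) }.

Section Subspace.
Variables (V : lmodType k) (W : subspace V).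

Definition subspace_pred : {pred V} := fun v => `[< W v >].

Lemma subspace_predE v : (v \in subspace_pred) = `[< W v >].
Proof. by []. Qed.

Lemma subspace_pred_closed : submod_closed subspace_pred.
Proof.
split=> [|a u v]; rewrite !subspace_predE; first exact/asboolP/subspace0.
by move=> /asboolP hu /asboolP hv; apply/asboolP/subspaceP.
Qed.

HB.instance Definition _ :=
  GRing.isSubmodClosed.Build k V subspace_pred subspace_pred_closed.

Record subsp := Subsp { subsp_val :> V; _ : subsp_val \in subspace_pred }.
HB.instance Definition _ := [isSub for subsp_val].
HB.instance Definition _ := [Choice of subsp by <:].
HB.instance Definition _ := [SubChoice_isSubZmodule of subsp by <:].
HB.instance Definition _ := [SubZmodule_isSubLmodule of subsp by <:].

Lemma subsp_mem (x : subsp) : W (subsp_val x).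
Proof. by case: x => x /= /asboolP. Qed.

Definition to_subsp v (Wv : W v) : subsp := @Subsp v (asboolT Wv).

Definition quotsp := Quotient.quot subspace_pred.
HB.instance Definition _ := GRing.Zmodule.on quotsp.
HB.instance Definition _ := Quotient.on quotsp.

Lemma quot_piP (u v : V) : \pi_quotsp u = \pi_quotsp v <-> W (u - v).
Proof.
split=> [/eqP|h].
  by rewrite eqquotE /= Quotient.equivE => /asboolP.
by apply/eqP; rewrite eqquotE /= Quotient.equivE; apply/asboolP.
Qed.

Lemma subspaceZ a u : W u -> W (a *: u).
Proof.
by move=> hu; rewrite -[_ *: _]addr0; apply: subspaceP => //; exact: subspace0.
Qed.

Lemma subspaceD u v : W u -> W v -> W (u + v).
Proof. by move=> hu hv; rewrite -[u]scale1r; apply: subspaceP. Qed.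

Lemma quot_piD (u v : V) : \pi_quotsp (u + v) = \pi_quotsp u + \pi_quotsp v.
Proof. exact (@Quotient.pi_add V subspace_pred u v). Qed.

Lemma quot_reprP (v : V) : W (repr (\pi_quotsp v) - v).
Proof. by apply/quot_piP; rewrite reprK. Qed.

Definition quot_scale (a : k) (x : quotsp) : quotsp := \pi_quotsp (a *: repr x).

Lemma quot_scaleE a v : quot_scale a (\pi_quotsp v) = \pi_quotsp (a *: v).
Proof. by apply/quot_piP; rewrite -scalerBr; apply/subspaceZ/quot_reprP. Qed.

Fact quot_scaleA a b (x : quotsp) :
  quot_scale a (quot_scale b x) = quot_scale (a * b) x.
Proof. by elim/quotW: x => v; rewrite [quot_scale b _]quot_scaleE !quot_scaleE scalerA. Qed.
Fact quot_scale1 : left_id 1 quot_scale.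
Proof. by elim/quotW=> v; rewrite quot_scaleE scale1r. Qed.
Fact quot_scaleDr : right_distributive quot_scale +%R.
Proof.
move=> a; elim/quotW=> u; elim/quotW=> v.
by rewrite -quot_piD !quot_scaleE scalerDr quot_piD.
Qed.
Fact quot_scaleDl (x : quotsp) : {morph quot_scale^~ x : a b / a + b}.
Proof. by move=> a b /=; elim/quotW: x => v; rewrite !quot_scaleE scalerDl quot_piD. Qed.

HB.instance Definition _ := GRing.Zmodule_isLmodule.Build k quotsp
  quot_scaleA quot_scale1 quot_scaleDr quot_scaleDl.

Definition quot_proj (v : V) : quotsp := \pi_quotsp v.

Fact quot_proj_linear : linear quot_proj.
Proof. by move=> a u v; rewrite /quot_proj quot_piD -quot_scaleE. Qed.
HB.instance Definition _ :=
  GRing.isLinear.Build k V quotsp *:%R quot_proj quot_proj_linear.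

End Subspace.

Section Lift.
Variables (V U : lmodType k) (W : subspace V) (f : {linear V -> U}).

Definition quot_lift (_ : forall v, W v -> f v = 0) (x : quotsp W) : U :=
  f (repr x).

Variable fW : forall v, W v -> f v = 0.

Lemma quot_liftE v : quot_lift fW (quot_proj W v) = f v.
Proof.
by apply/eqP; rewrite -subr_eq0 -linearB; apply/eqP/fW/quot_reprP.
Qed.

Fact quot_lift_linear : linear (quot_lift fW).
Proof.
move=> a; elim/quotW=> u; elim/quotW=> v; rewrite -![\pi _]/(quot_proj W _).
by rewrite -linearP !quot_liftE linearP.
Qed.
HB.instance Definition _ :=
  GRing.isLinear.Build k (quotsp W) U *:%R (quot_lift fW) quot_lift_linear.

Definition image_set (u : U) := exists v, u = f v.
Fact image_set0 : image_set 0. Proof. by exists 0; rewrite linear0. Qed.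
Fact image_setP a u v : image_set u -> image_set v -> image_set (a *: u + v).
Proof. by move=> [x ->] [y ->]; exists (a *: x + y); rewrite linearP. Qed.
Definition image_subspace : subspace U := Subspace image_set0 image_setP.

End Lift.

Section Subquotient.
Variables (V : lmodType k) (M N : subspace V).

Definition inner_set (x : subsp M) := N (subsp_val x).
Fact inner_set0 : inner_set 0.
Proof. by rewrite /inner_set /=; exact: subspace0. Qed.
Fact inner_setP a x y : inner_set x -> inner_set y -> inner_set (a *: x + y).
Proof. by rewrite /inner_set /= => hx hy; exact: subspaceP. Qed.
Definition inner_subspace : subspace (subsp M) :=
  Subspace inner_set0 inner_setP.

(** [M / N]; in every use below [N] is contained in [M]. *)
Definition subquot := quotsp inner_subspace.
HB.instance Definition _ := GRing.Lmodule.on subquot.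
HB.instance Definition _ := Quotient.on subquot.

Definition subquot_class v (Mv : M v) : subquot :=
  quot_proj inner_subspace (to_subsp Mv).

Definition subquot_repr (x : subquot) : V := subsp_val (repr x).

Lemma subquotW (P : subquot -> Prop) :
  (forall v (Mv : M v), P (subquot_class Mv)) -> forall x, P x.
Proof.
move=> h; elim/quotW => v; suff -> : v = to_subsp (subsp_mem v) by exact: h.
exact: val_inj.
Qed.

Lemma subquot_reprP x : M (subquot_repr x).
Proof. exact: subsp_mem. Qed.

Lemma subquot_repr_class v (Mv : M v) : N (subquot_repr (subquot_class Mv) - v).
Proof. exact: (@quot_reprP _ inner_subspace (to_subsp Mv)). Qed.

End Subquotient.

Section SubquotientMaps.
Variables (V U : lmodType k) (M N : subspace V) (f : {linear V -> U}).

Definition on_subsp (x : subsp M) : U := f (subsp_val x).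
Fact on_subsp_linear : linear on_subsp.
Proof. by move=> a x y; rewrite /on_subsp /= linearP. Qed.
HB.instance Definition _ :=
  GRing.isLinear.Build k (subsp M) U *:%R on_subsp on_subsp_linear.

Fact subquot_lift_subproof (fN : forall v, M v -> N v -> f v = 0) x :
  inner_subspace M N x -> on_subsp x = 0.
Proof. by move=> h; apply: fN => //; exact: subsp_mem. Qed.

Definition subquot_lift (fN : forall v, M v -> N v -> f v = 0) :
    {linear subquot M N -> U} :=
  quot_lift (subquot_lift_subproof fN).

Lemma subquot_liftE fN v (Mv : M v) :
  subquot_lift fN (subquot_class N Mv) = f v.
Proof. exact: quot_liftE. Qed.

Variables M' N' : subspace U.
Hypothesis fM : forall v, M v -> M' (f v).

Definition between_subsp (x : subsp M) : subsp M' :=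
  to_subsp (fM (subsp_mem x)).
Fact between_subsp_linear : linear between_subsp.
Proof. by move=> a x y; apply: val_inj; rewrite /= linearP. Qed.
HB.instance Definition _ :=
  GRing.isLinear.Build k (subsp M) (subsp M') *:%R between_subsp
    between_subsp_linear.

Definition to_subquot (x : subsp M) : subquot M' N' :=
  quot_proj (inner_subspace M' N') (between_subsp x).
Fact to_subquot_linear : linear to_subquot.
Proof. by move=> a x y; rewrite /to_subquot !linearP. Qed.
HB.instance Definition _ :=
  GRing.isLinear.Build k (subsp M) (subquot M' N') *:%R to_subquot
    to_subquot_linear.

Fact subquot_map_subproof (fN : forall v, M v -> N v -> N' (f v)) x :
  inner_subspace M N x -> to_subquot x = 0.
Proof.
move=> h; rewrite /to_subquot -[RHS](linear0 (quot_proj (inner_subspace M' N'))).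
apply/quot_piP; rewrite subr0; apply: fN => //; exact: subsp_mem.
Qed.

Definition subquot_map (fN : forall v, M v -> N v -> N' (f v)) :
    {linear subquot M N -> subquot M' N'} :=
  quot_lift (subquot_map_subproof fN).

Lemma subquot_mapE fN v (Mv : M v) :
  subquot_map fN (subquot_class N Mv) = subquot_class N' (fM Mv).
Proof.
rewrite /subquot_map [LHS]quot_liftE /to_subquot.
by congr (quot_proj _ _); apply: val_inj.
Qed.

End SubquotientMaps.

Definition has_dim (V : lmodType k) (n : nat) :=
  exists f : {linear 'rV[k]_n -> V}, bijective f.

(** The inverse of a bijection (an arbitrary function if [f] is not one). *)
Definition inverse (A : lmodType k) (B : Type) (f : A -> B) (y : B) : A :=
  xget 0 [set x | f x = y]%classic.

End LinearAlgebra.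

Section Curve.
Variable k : closedFieldType.

(** An integral closed subvariety of the projective space of dimension [n] over
    the algebraically closed field [k], presented by its function field [K]
    and its generic point [(x_0 : ... : x_n)], a point with coordinates in
    [K]: the homogeneous prime ideal of the variety consists of the forms
    vanishing at the generic point, and [K] consists of the quotients
    [F(x) / G(x)] of forms of the same degree. *)
Record proj_variety := ProjVariety {
  proj_dim : nat;
  function_field :> fieldAlgType k;
  coord : 'I_proj_dim.+1 -> function_field;
  coord_neq0 : exists i, coord i != 0;
  function_fieldP : forall f : function_field,
    exists d (F G : {mpoly k[proj_dim.+1]}),
      [/\ F \is d.-homog, G \is d.-homog,
          mmap (in_alg function_field) coord G != 0
        & f = mmap (in_alg function_field) coord F
              / mmap (in_alg function_field) coord G] }.

Variable C : proj_variety.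
Local Notation n := (proj_dim C).
Local Notation K := (function_field C).

Definition form_value (F : {mpoly k[n.+1]}) : K := mmap (in_alg K) (@coord C) F.

(** A point of projective space is represented by its homogeneous coordinates
    normalized so that the first nonzero one is [1]; it lies on the variety if
    every form in the ideal of the variety vanishes at it. *)
Definition is_point (a : {ffun 'I_n.+1 -> k}) : Prop :=
  (exists i, a i = 1 /\ forall j : 'I_n.+1, (j < i)%N -> a j = 0) /\
  (forall d (F : {mpoly k[n.+1]}), F \is d.-homog ->
     form_value F = 0 -> F.@[a] = 0).

Record point := Point {
  point_coord :> {ffun 'I_n.+1 -> k}; _ : `[< is_point point_coord >] }.
HB.instance Definition _ := [isSub for point_coord].
HB.instance Definition _ := [Choice of point by <:].

(** The local ring of the variety at [P], as a subring of [K], and its maximal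
    ideal. *)
Definition local_ring (P : point) (f : K) : Prop :=
  exists d (F G : {mpoly k[n.+1]}),
    [/\ F \is d.-homog, G \is d.-homog, G.@[P] != 0
      & f = form_value F / form_value G].

Definition max_ideal (P : point) (f : K) : Prop :=
  exists d (F G : {mpoly k[n.+1]}),
    [/\ F \is d.-homog, G \is d.-homog, F.@[P] = 0, G.@[P] != 0
      & f = form_value F / form_value G].

Definition uniformizer (P : point) (t : K) : Prop :=
  [/\ t != 0, max_ideal P t
    & forall f, max_ideal P f -> local_ring P (f / t)].

(** The variety is a smooth curve: every local ring at a closed point is
    regular of dimension one, that is, a discrete valuation ring with fraction
    field [K]. *)
Definition smooth_curve : Prop :=
  forall P : point, exists t, uniformizer P t /\
    forall f : K, f != 0 -> exists m : int,
      local_ring P (f * t ^ (- m)) /\ local_ring P (f^-1 * t ^ m).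

Lemma form_valueD F G : form_value (F + G) = form_value F + form_value G.
Proof. exact: raddfD. Qed.
Lemma form_valueZ a F : form_value (a *: F) = a *: form_value F.
Proof. by rewrite /form_value mmapZ mulr_algl. Qed.
Lemma form_valueM F G : form_value (F * G) = form_value F * form_value G.
Proof. exact: rmorphM. Qed.

Lemma form_value_neq0 (P : point) d (G : {mpoly k[n.+1]}) :
  G \is d.-homog -> G.@[P] != 0 -> form_value G != 0.
Proof.
case: P => a /= /asboolP [_ ha] hG; apply: contra_neq; exact: ha hG.
Qed.

Lemma local_ring0 P : local_ring P 0.
Proof.
exists 0%N, 0, 1; rewrite rpred0 dhomog1 meval1 oner_neq0; split=> //.
by rewrite /form_value mmap0 mul0r.
Qed.

Lemma local_ringP P a f g :
  local_ring P f -> local_ring P g -> local_ring P (a *: f + g).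
Proof.
move=> [d [F [G [hF hG GP ->]]]] [e [F' [G' [hF' hG' GP' ->]]]].
exists (d + e)%N, (a *: (F * G') + F' * G), (G * G'); split.
- by apply: rpredD; [apply: rpredZ; exact: dhomogM
                    | rewrite addnC; exact: dhomogM].
- exact: dhomogM.
- by rewrite mevalM mulf_neq0.
have nG := form_value_neq0 hG GP; have nG' := form_value_neq0 hG' GP'.
rewrite form_valueD form_valueZ !form_valueM scalerAl addf_div //.
by rewrite scalerAl.
Qed.

Lemma local_ringM P f g :
  local_ring P f -> local_ring P g -> local_ring P (f * g).
Proof.
move=> [d [F [G [hF hG GP ->]]]] [e [F' [G' [hF' hG' GP' ->]]]].
exists (d + e)%N, (F * F'), (G * G'); split; try exact: dhomogM.
  by rewrite mevalM mulf_neq0.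
by rewrite !form_valueM mulf_div.
Qed.

Lemma local_ring1 P : local_ring P 1.
Proof.
exists 0%N, 1, 1; rewrite dhomog1 meval1 oner_neq0; split=> //.
by rewrite divff // (@form_value_neq0 P 0) ?dhomog1 ?meval1 ?oner_neq0.
Qed.

Lemma local_ringX P f m : local_ring P f -> local_ring P (f ^+ m).
Proof.
move=> hf; elim: m => [|m IH]; first exact: local_ring1.
by rewrite exprS; exact: local_ringM.
Qed.

Lemma max_ideal_local P f : max_ideal P f -> local_ring P f.
Proof. by move=> [d [F [G [hF hG _ GP ->]]]]; exists d, F, G. Qed.

(** The fractional ideal [m_P^(-m)] of functions with a pole of order at most
    [m] at [P]. *)
Definition pole_set (P : point) (m : int) (f : K) : Prop :=
  forall t, uniformizer P t -> local_ring P (f * t ^ m).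

Fact pole_set0 P m : pole_set P m 0.
Proof. by move=> t _; rewrite mul0r; exact: local_ring0. Qed.
Fact pole_setP P m a f g :
  pole_set P m f -> pole_set P m g -> pole_set P m (a *: f + g).
Proof.
move=> hf hg t ht; rewrite mulrDl -scalerAl.
by apply: local_ringP; [exact: hf | exact: hg].
Qed.
Definition pole P m : subspace K := Subspace (@pole_set0 P m) (@pole_setP P m).

Lemma pole_mono P (m m' : int) f : m <= m' -> pole P m f -> pole P m' f.
Proof.
move=> le hf t ht; have [t0 mt _] := ht.
rewrite -[m'](subrK m) addrC expfzDr // mulrA; apply: local_ringM.
  exact: hf.
move: le; rewrite -subr_ge0; case: (m' - m) => // l _.
by apply/local_ringX/max_ideal_local.
Qed.

Lemma poleM P m m' f g : pole P m f -> pole P m' g -> pole P (m + m') (f * g).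
Proof.
move=> hf hg t ht; have [t0 _ _] := ht.
by rewrite expfzDr // mulrACA; apply: local_ringM; [exact: hf | exact: hg].
Qed.

(** The tangent line [T_P], realized as [H^0(O(P)/O)]: a function with at most
    a simple pole at [P] defines by multiplication a linear form on the
    cotangent line, the quotient of the maximal ideal by its square. *)
Definition tangent P := subquot (pole P 1) (pole P 0).
HB.instance Definition _ P := GRing.Lmodule.on (tangent P).

(** Its tensor square, realized as [H^0(O(2P)/O(P))]. *)
Definition tangent2 P := subquot (pole P 2) (pole P 1).
HB.instance Definition _ P := GRing.Lmodule.on (tangent2 P).

Definition tangent_mul P (s t : tangent P) : tangent2 P :=
  subquot_class (pole P 1)
    (poleM (subquot_reprP s) (subquot_reprP t) : pole P 2 _).

Lemma tangent_mulE P f g (hf : pole P 1 f) (hg : pole P 1 g) :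
  tangent_mul (subquot_class (pole P 0) hf) (subquot_class (pole P 0) hg)
  = subquot_class (pole P 1) (poleM hf hg : pole P 2 (f * g)).
Proof.
apply/quot_piP; rewrite /= /inner_set /=.
set s := subquot_class _ hf; set t := subquot_class _ hg.
have hs : pole P 0 (subquot_repr s - f) := subquot_repr_class _ hf.
have ht : pole P 0 (subquot_repr t - g) := subquot_repr_class _ hg.
have -> : subquot_repr s * subquot_repr t - f * g
    = (subquot_repr s - f) * subquot_repr t + f * (subquot_repr t - g).
  by rewrite mulrBl mulrBr addrA subrK.
apply: (@subspaceD _ _ (pole P 1)).
  exact: poleM hs (subquot_reprP t).
exact: poleM hf ht.
Qed.

Definition divisor := point -> int.
HB.instance Definition _ := GRing.Zmodule.on divisor.

Definition div_point (P : point) : divisor := fun Q => (Q == P)%:Z.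

Lemma div_point_ge0 P Q : 0 <= div_point P Q.
Proof. by []. Qed.

(** [H^0(C, O(E))], as a subspace of the function field. *)
Definition sections_set (E : divisor) (f : K) : Prop :=
  forall P, pole P (E P) f.
Fact sections_set0 E : sections_set E 0.
Proof. by move=> P; exact: subspace0. Qed.
Fact sections_setP E a f g :
  sections_set E f -> sections_set E g -> sections_set E (a *: f + g).
Proof. by move=> hf hg P; exact: subspaceP. Qed.
Definition sections E : subspace K :=
  Subspace (@sections_set0 E) (@sections_setP E).

(** [H^1(C, O(E))] is computed from the flasque resolution
    [0 -> O(E) -> K -> \bigoplus_P K / O(E)_P -> 0]: it is the space of adeles
    (families of functions indexed by the points, almost all regular at their
    point) modulo the adeles [a] for which there is [f] in [K] such that
    [a_P - f] is in [O(E)_P] for every [P]. *)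
Definition adele_set (a : point -> K) : Prop :=
  exists s : seq point, forall P, P \notin s -> local_ring P (a P).
Fact adele_set0 : adele_set 0.
Proof. by exists [::] => P _; exact: local_ring0. Qed.
Fact adele_setP c a b : adele_set a -> adele_set b -> adele_set (c *: a + b).
Proof.
move=> [s hs] [s' hs']; exists (s ++ s') => P; rewrite mem_cat negb_or.
by move=> /andP [/hs h /hs' h']; exact: local_ringP.
Qed.
Definition adeles : subspace (point -> K) := Subspace adele_set0 adele_setP.

Definition principal_mod_set (E : divisor) (a : point -> K) : Prop :=
  exists f : K, forall P, pole P (E P) (a P - f).
Fact principal_mod_set0 E : principal_mod_set E 0.
Proof. by exists 0 => P; rewrite subr0; exact: subspace0. Qed.
Fact principal_mod_setP E c a b :
  principal_mod_set E a -> principal_mod_set E b ->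
  principal_mod_set E (c *: a + b).
Proof.
move=> [f hf] [g hg]; exists (c *: f + g) => P.
by rewrite opprD addrACA -scalerBr; exact: subspaceP.
Qed.
Definition principal_mod E : subspace (point -> K) :=
  Subspace (@principal_mod_set0 E) (@principal_mod_setP E).

Definition H1 (E : divisor) := subquot adeles (principal_mod E).
HB.instance Definition _ E := GRing.Lmodule.on (H1 E).
HB.instance Definition _ E := Quotient.on (H1 E).

(** The class in [H^1(C, O(E))] of a principal part [f] concentrated at [P]. *)
Definition at_point (P : point) (f : K) : point -> K :=
  fun Q => if Q == P then f else 0.
Fact at_point_linear P : linear (at_point P).
Proof.
move=> a f g; apply/funext => Q.
transitivity (a *: at_point P f Q + at_point P g Q); last by [].
by rewrite /at_point; case: ifP; rewrite // scaler0 addr0.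
Qed.
HB.instance Definition _ P :=
  GRing.isLinear.Build k K (point -> K) *:%R (at_point P) (at_point_linear P).
Fact at_point_adele P f : adeles (at_point P f).
Proof.
exists [:: P] => Q; rewrite inE /at_point => /negbTE ->.
exact: local_ring0.
Qed.

Definition principal_part E P (f : K) : H1 E :=
  subquot_class (principal_mod E) (at_point_adele P f).
Fact principal_part_linear E P : linear (principal_part E P).
Proof.
move=> a f g; rewrite /principal_part /subquot_class -linearP.
by congr (quot_proj _ _); apply: val_inj; rewrite /= linearP.
Qed.
HB.instance Definition _ E P :=
  GRing.isLinear.Build k K (H1 E) *:%R (principal_part E P)
    (principal_part_linear E P).

Lemma principal_part_eq0 E P m (mE : E P = m) f :
  pole P m f -> principal_part E P f = 0.
Proof.
move=> hf.
rewrite -[RHS](linear0 (quot_proj (inner_subspace adeles (principal_mod E)))).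
apply/quot_piP; rewrite subr0 /= /inner_set /=; exists 0 => Q; rewrite subr0.
by rewrite /at_point; case: eqP => [->|_]; [rewrite mE | exact: subspace0].
Qed.

(** The connecting homomorphism [H^0(O(m'P)/O(mP)) -> H^1(C, O(E))] of
    [0 -> O(E) -> O(E + (m' - m)P) -> O(m'P)/O(mP) -> 0], where [m] is the
    multiplicity of [P] in [E]: a principal part is sent to the class of the
    adele that it defines. *)
Definition connecting E P m m' (mE : E P = m) :
    {linear subquot (pole P m') (pole P m) -> H1 E} :=
  subquot_lift (f := principal_part E P)
    (fun f _ hf => principal_part_eq0 mE hf).

(** [T_P -> H^1(C, O)]; its image is the line spanned by [xi_P]. *)
Definition xi_map P : {linear tangent P -> H1 0} :=
  @connecting 0 P 0 1 erefl.

Definition H1_mod_xi P := quotsp (image_subspace (xi_map P)).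
HB.instance Definition _ P := GRing.Lmodule.on (H1_mod_xi P).

Definition proj_mod_xi P : {linear H1 0 -> H1_mod_xi P} :=
  quot_proj (image_subspace (xi_map P)).

Lemma div_pointP P : div_point P P = 1.
Proof. by rewrite /div_point eqxx. Qed.

(** [H^1(C, O) -> H^1(C, O(P))] and the induced isomorphism
    [H^1(C, O) / <xi_P> -> H^1(C, O(P))]. *)
Fact H1_twist_subproof P a :
  adeles a -> principal_mod 0 a -> principal_mod (div_point P) (idfun a).
Proof. by move=> _ [f hf]; exists f => Q; apply: pole_mono (hf Q). Qed.
Definition H1_twist P : {linear H1 0 -> H1 (div_point P)} :=
  subquot_map (f := idfun) (fun _ h => h) (@H1_twist_subproof P).

Fact H1_mod_xi_twist_subproof P y :
  image_subspace (xi_map P) y -> H1_twist P y = 0.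
Proof.
move=> [s ->]; elim/subquotW: s => f hf.
rewrite /xi_map /connecting subquot_liftE /H1_twist subquot_mapE.
rewrite -(principal_part_eq0 (div_pointP P) hf).
by congr (quot_proj _ _); apply: val_inj.
Qed.
Definition H1_mod_xi_twist P : {linear H1_mod_xi P -> H1 (div_point P)} :=
  quot_lift (@H1_mod_xi_twist_subproof P).

(** The map [delta'_P : T_P -> Hom(T_P, H^1(C, O) / <xi_P>)]: the
    identification of [T_P] with [Hom(T_P, T_P^2)], followed by the connecting
    homomorphism [H^0(O(2P)/O(P)) -> H^1(C, O(P))] and the inverse of
    [H1_mod_xi_twist]. *)
Definition delta' P (s t : tangent P) : H1_mod_xi P :=
  inverse (H1_mod_xi_twist P)
    (@connecting (div_point P) P 1 2 (div_pointP P) (tangent_mul s t)).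

(** The restriction (polar part) map
    [H^0(C, O(E)) / H^0(C, O) -> H^0(O(m'P)/O(mP))]. *)
Fact polar_part_subproof1 (E : divisor) P m' (hm' : E P <= m') f :
  sections E f -> pole P m' (idfun f).
Proof. by move=> h; exact: pole_mono (h P). Qed.
Fact polar_part_subproof2 (E : divisor) P m (hm : 0 <= m) f :
  sections E f -> sections 0 f -> pole P m (idfun f).
Proof. by move=> _ h; exact: pole_mono (h P). Qed.
Definition polar_part E P m m' (hm' : E P <= m') (hm : 0 <= m) :
    {linear subquot (sections E) (sections 0)
            -> subquot (pole P m') (pole P m)} :=
  subquot_map (f := idfun) (polar_part_subproof1 hm')
    (polar_part_subproof2 hm).

Section Points.
Variables (g : nat) (p : 'I_g -> point).

Definition div_points : divisor := \sum_j div_point (p j).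

(** [\bigoplus_j T_{p_j} -> H^1(C, O)] and the map
    [\bigoplus_{j != i} T_{p_j} -> H^1(C, O) / <xi_{p_i}>] that it induces. *)
Definition tangent_sum (s : forall j, tangent (p j)) : H1 0 :=
  \sum_j xi_map (p j) (s j).

Definition tangent_sum_mod i (s : forall j : {j | j != i}, tangent (p (val j))) :
    H1_mod_xi (p i) :=
  \sum_(j : {j | j != i}) proj_mod_xi (p i) (xi_map (p (val j)) (s j)).

Hypothesis p_inj : injective p.

Lemma div_points_val i j : (div_points + div_point (p i)) (p j) = 1 + (j == i)%:Z.
Proof.
transitivity (div_points (p j) + div_point (p i) (p j)); first by [].
rewrite /div_points fct_sumE /div_point (inj_eq p_inj); congr (_ + _).
rewrite (bigD1 j) //= eqxx big1 ?addr0 // => l lj.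
by rewrite (inj_eq p_inj) eq_sym (negbTE lj).
Qed.

Fact polar_le i : (div_points + div_point (p i)) (p i) <= 2.
Proof. by rewrite div_points_val eqxx. Qed.
Fact polar_le_ne i j : j != i -> (div_points + div_point (p i)) (p j) <= 1.
Proof. by rewrite div_points_val => /negbTE ->. Qed.

Definition sections_mod_const i :=
  subquot (sections (div_points + div_point (p i))) (sections 0).
HB.instance Definition _ i := GRing.Lmodule.on (sections_mod_const i).

Definition polar_i i : {linear sections_mod_const i -> tangent2 (p i)} :=
  polar_part (m := 1) (polar_le i) ler01.
Definition polar_ij i j (ji : j != i) :
    {linear sections_mod_const i -> tangent (p j)} :=
  polar_part (m := 0) (polar_le_ne ji) (lexx 0).

Definition alpha i j (ji : j != i) (x : tangent2 (p i)) : tangent (p j) :=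
  polar_ij ji (inverse (polar_i i) x).

End Points.

Definition is_derivation (M : lmodType K) (D : K -> M) : Prop :=
  (forall (a : k) f g, D (a *: f + g) = a%:A *: D f + D g) /\
  (forall f g, D (f * g) = f *: D g + g *: D f).

(** [d : K -> Om] is the module of Kaehler differentials of [K] over [k]. *)
Definition is_kaehler (Om : lmodType K) (d : K -> Om) : Prop :=
  is_derivation d /\
  forall (M : lmodType K) (D : K -> M), is_derivation D ->
    exists phi : {linear Om -> M}, (forall f, phi (d f) = D f) /\
      forall psi : {linear Om -> M}, (forall f, psi (d f) = D f) -> psi =1 phi.

(** A [K]-module seen as a [k]-vector space. *)
Definition restrict_scalars (M : lmodType K) : Type := M.

Section RestrictScalars.
Variable M : lmodType K.
HB.instance Definition _ := GRing.Zmodule.on (restrict_scalars M).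
Definition restrict_scale (a : k) (v : restrict_scalars M) :
  restrict_scalars M := (a%:A : K) *: (v : M).
Fact restrict_scaleA a b v :
  restrict_scale a (restrict_scale b v) = restrict_scale (a * b) v.
Proof. by rewrite /restrict_scale scalerA mulr_algl scalerA. Qed.
Fact restrict_scale1 : left_id 1 restrict_scale.
Proof. by move=> v; rewrite /restrict_scale !scale1r. Qed.
Fact restrict_scaleDr : right_distributive restrict_scale +%R.
Proof. by move=> a u v; rewrite /restrict_scale scalerDr. Qed.
Fact restrict_scaleDl v : {morph restrict_scale^~ v : a b / a + b}.
Proof. by move=> a b; rewrite /restrict_scale !scalerDl. Qed.
HB.instance Definition _ := GRing.Zmodule_isLmodule.Build k (restrict_scalars M)
  restrict_scaleA restrict_scale1 restrict_scaleDr restrict_scaleDl.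
End RestrictScalars.

Section Differentials.
Variables (Om : lmodType K) (d : K -> Om).

(** The stalk of [omega_C(E)] at [P]: the sums of [f * dg] with [f] in
    [O(E)_P] and [g] in [O_P]. *)
Definition omega_stalk (E : divisor) P (eta : Om) : Prop :=
  exists r : seq (K * K),
    (forall x, x \in r -> pole P (E P) x.1 /\ local_ring P x.2) /\
    eta = \sum_(x <- r) x.1 *: d x.2.

(** [H^0(C, omega_C(E))] *)
Definition omega_sections_set E (eta : restrict_scalars Om) : Prop :=
  forall P, omega_stalk E P eta.
Fact omega_sections_set0 E : omega_sections_set E 0.
Proof. by move=> P; exists [::]; rewrite big_nil. Qed.
Fact omega_sections_setP E a u v : omega_sections_set E u ->
  omega_sections_set E v -> omega_sections_set E (a *: u + v).
Proof.
move=> hu hv P; have [[r [hr ->]] [r' [hr' ->]]] := (hu P, hv P).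
exists ([seq (a *: x.1, x.2) | x <- r] ++ r'); split=> [x|].
  rewrite mem_cat => /orP[/mapP[y /hr [y1 y2] ->]|/hr' //].
  by split=> //; exact: (@subspaceZ _ _ (pole P (E P))).
rewrite big_cat big_map /=; congr (_ + _).
rewrite [LHS](@scaler_sumr K Om).
by apply: eq_bigr => x _; rewrite scalerA mulr_algl.
Qed.
Definition omega_sections E : subspace (restrict_scalars Om) :=
  Subspace (@omega_sections_set0 E) (@omega_sections_setP E).

Definition H0_omega := subsp (omega_sections 0).
HB.instance Definition _ := GRing.Lmodule.on H0_omega.

Definition H0_omega_val (eta : H0_omega) : Om := subsp_val eta.

(** [c] is the residue of [eta] at [P], computed in the Laurent expansion with
    respect to some uniformizer [t] (it does not depend on [t]). *)
Definition is_residue P (eta : Om) (c : k) : Prop :=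
  exists t m (a : nat -> k) (h : K),
    [/\ uniformizer P t, local_ring P h, c = a 0%N
      & eta = (\sum_(j < m.+1) a j *: t ^- j.+1 + h) *: d t].

(** [S] is the Serre duality isomorphism from [H^1(C, O)] to the dual of
    [H^0(C, omega_C)]: the adele [a] is sent to the linear form
    [eta |-> \sum_P res_P (a_P * eta)]. By linearity it is enough to prescribe
    this for the adeles concentrated at one point, since an adele is, up to an
    everywhere regular one, a finite sum of such adeles. *)
Definition serre_duality (S : H1 0 -> {linear H0_omega -> k^o}) : Prop :=
  [/\ forall (a : k) x y eta, S (a *: x + y) eta = a * S x eta + S y eta,
      forall l : {linear H0_omega -> k^o}, exists! y, S y =1 l
    & forall P (f : K) (eta : H0_omega) (c : k),
        is_residue P (f *: H0_omega_val eta) c ->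
        S (principal_part 0 P f) eta = c].

(** The value of a regular differential [eta = \sum f * dh] at [P], with every
    [f] in [O_P] and every [h] in the maximal ideal, is the cotangent vector
    class of [\sum f(P) * h]; [is_omega_value P t eta c] says that its pairing
    with the tangent vector given by the function [t] is [c]. *)
Definition is_omega_value P (t : K) (eta : Om) (c : k) : Prop :=
  exists r : seq (K * K),
    [/\ forall x, x \in r -> local_ring P x.1 /\ max_ideal P x.2,
        eta = \sum_(x <- r) x.1 *: d x.2
      & max_ideal P ((\sum_(x <- r) x.1 * x.2) * t - c%:A)].

Definition omega_value P (t : tangent P) (eta : Om) : k :=
  xget 0 [set c | is_omega_value P (subquot_repr t) eta c]%classic.

(** The canonical morphism sends [P] to the line in the dual of
    [H^0(C, omega_C)] spanned by the evaluation at [P]. As the fibre of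
    [omega_C] at [P] is the dual of [T_P], the evaluation is a map from [T_P]
    to the dual of [H^0(C, omega_C)]. *)
Definition ev P (t : tangent P) (eta : H0_omega) : k :=
  omega_value t (H0_omega_val eta).

(** The tangent map at [P] to the canonical morphism, from [T_P] to the space
    of bilinear forms on [T_P] x [H^0(C, omega_C(-P))]; here the dual of
    the latter space is the quotient of the dual of [H^0(C, omega_C)] by the
    image of [ev]. It is dual to the evaluation
    [H^0(C, omega_C(-P)) -> omega_C(-P)|_P], whose target is identified with
    [Hom(T_P, omega_C|_P)] by multiplication by the functions representing
    elements of [T_P]. *)
Definition canonical_tangent_map P (s t : tangent P) (eta : Om) : k :=
  omega_value t (subquot_repr s *: eta).

End Differentials.
End Curve.

(* Main.v *)
From HB Require Import structures.
From mathcomp Require Import all_boot all_order all_algebra ring.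
From mathcomp Require Import mpoly boolp classical_sets functions.
Require Import Defs.
Set Implicit Arguments.
Unset Strict Implicit.
Unset Printing Implicit Defensive.
Import GRing.Theory.
Local Open Scope ring_scope.

(** Since [h^0(D) = 1], a combination of principal parts with simple poles at
    the [p_j] vanishes in [H^1(C, O)] only if it is trivial, so by dimension
    the [T_{p_j}] span [H^1(C, O)]. Consequently any polar part [s t] of order
    two at [p_i] extends to a global [h] in [H^0(O(D + p_i))]. As a diagonal
    adele, [h] is zero in [H^1]; hence the class of [s t] at [p_i] is minus the
    sum of the classes of the polar parts of [h] at the other [p_j], which is
    where the sign in front of [alpha_ij] comes from.

    On the side of differentials, Nakayama's lemma gives [d O_P = O_P du] for a
    uniformizer [u], and [du <> 0] because otherwise there would be no
    differentials, against Serre duality and [g > 0]. For [eta = q du] both the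
    residue of [f eta] and the value of [eta] on [f] are then [(q u f)(P)]. *)

(** * Bijections and dependent families *)

Lemma inj_surj_bijective (A B : Type) (f : A -> B) :
  injective f -> (forall y, exists x, f x = y) -> bijective f.
Proof.
move=> f_inj /choice [h fh]; exists h => // x.
exact/f_inj/fh.
Qed.

(** Completes tangent vectors given at the points other than [p i] by a chosen vector at [p i], so
    that injectivity of [tangent_sum] can be applied. *)
Lemma dep_extension (I : eqType) (T : I -> Type) (i : I) (r : T i)
    (s : forall j : {j | j != i}, T (val j)) :
  exists t : forall j, T j, t i = r /\ forall j : {j | j != i}, t (val j) = s j.
Proof.
(* The value at [j] is specified against all proofs of [i = j] and of [j != i]; it can then be
   chosen from a mere existence statement. *)
suff h j : exists x : T j, (forall e : i = j, x = ecast j (T j) e r) /\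
    forall ji : j != i, x = s (exist _ j ji).
  exists (fun j => projT1 (cid (h j))); split.
    by case: (cid _) => x [xr _] /=; rewrite (xr erefl).
  move=> [j ji] /=; case: (cid _) => x [_ xs] /=.
  exact: xs.
have [ij|/eqP ji] := pselect (i = j); last first.
  have ji' : j != i by rewrite eq_sym.
  exists (s (exist _ j ji')); split=> [e|ji2]; first by rewrite e eqxx in ji.
  by rewrite (bool_irrelevance ji2 ji').
case: j / ij; exists r; split=> [e|]; first by rewrite eq_axiomK.
by move=> ii; exfalso; rewrite eqxx in ii.
Qed.

(** * Vector spaces of given dimension *)

Section Dimension.
Variables (k : fieldType) (V : lmodType k).

Lemma has_dim1_colinear (x y : V) :
  has_dim V 1 -> y != 0 -> exists a : k, x = a *: y.
Proof.
move=> [f [f' fK f'K]] y0; have [u ux] : exists u, f u = x by exists (f' x).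
have [v vy] : exists v, f v = y by exists (f' y).
have v0 : v 0 0 != 0.
  apply: contra_neq y0 => v0; rewrite -vy -[RHS](linear0 f); congr (f _).
  by apply/rowP => i; rewrite ord1 v0 mxE.
exists (u 0 0 / v 0 0); rewrite -vy -linearZ -ux; congr (f _).
by apply/rowP => i; rewrite ord1 !mxE divfK.
Qed.

(** In coordinates on [V], [f] is a square matrix with trivial kernel, hence invertible. *)
Lemma has_dim_inj_surj n (f : {linear 'rV[k]_n -> V}) :
  has_dim V n -> injective f -> forall y, exists x, f x = y.
Proof.
move=> [b [b' bK b'K]] f_inj y.
have b'_lin : linear b' by move=> a u v; rewrite -{1}[u]b'K -{1}[v]b'K -linearP bK.
pose h := GRing.isLinear.Build k V 'rV[k]_n *:%R b' b'_lin.
pose bl : {linear V -> 'rV[k]_n} := HB.pack b' h.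
pose A := lin1_mx (bl \o f).
have fA u : b (u *m A) = f u by rewrite mul_rV_lin1 /= b'K.
have A_unit : A \in unitmx.
  rewrite -row_free_unit; apply: inj_row_free => v /(congr1 b).
  by rewrite fA linear0 -[RHS](linear0 f) => /f_inj.
by exists (b' y *m invmx A); rewrite -fA mulmxKV.
Qed.

End Dimension.

(** * The local ring at a point and its residue field *)

Section LocalRing.
Variables (k : closedFieldType) (C : proj_variety k).
Local Notation K := (function_field C).
Local Notation n := (proj_dim C).
Implicit Types (P Q : point C) (f g : K).

Lemma form_valueB (F G : {mpoly k[n.+1]}) :
  form_value (F - G) = form_value F - form_value G :> K.
Proof. exact: raddfB. Qed.

Lemma local_ringZ P (a : k) f : local_ring P f -> local_ring P (a *: f).
Proof.
by move=> hf; rewrite -[_ *: _]addr0; apply: local_ringP => //; exact: local_ring0.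
Qed.
Lemma local_ringD P f g : local_ring P f -> local_ring P g -> local_ring P (f + g).
Proof. by move=> hf hg; rewrite -[f]scale1r; exact: local_ringP. Qed.
Lemma local_ringN P f : local_ring P f -> local_ring P (- f).
Proof. by rewrite -scaleN1r; exact: local_ringZ. Qed.
Lemma local_ringC P (a : k) : local_ring P (a%:A : K).
Proof. exact/local_ringZ/local_ring1. Qed.

Lemma max_idealMr P f g : max_ideal P f -> local_ring P g -> max_ideal P (f * g).
Proof.
move=> [d [F [G [hF hG FP GP ->]]]] [e [F' [G' [hF' hG' GP' ->]]]].
exists (d + e)%N, (F * F'), (G * G'); split; try exact: dhomogM.
- by rewrite mevalM FP mul0r.
- by rewrite mevalM mulf_neq0.
by rewrite !form_valueM mulf_div.
Qed.

(** If [F / G = 1], the form [F - G] vanishes at the generic point, hence at [P], and [F(P) = 0]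
    forces [G(P) = 0]. *)
Lemma max_ideal_neq1 P : ~ max_ideal P 1.
Proof.
move=> [d [F [G [hF hG FP GP e]]]]; have nG := form_value_neq0 hG GP.
have FG : form_value (F - G) = 0.
  rewrite form_valueB.
  by rewrite -(divfK nG (form_value F)) -e mul1r subrr.
case: P FP GP => a /= /asboolP [_ ha] FP /eqP []; rewrite -[RHS]FP.
by apply/esym/eqP; rewrite -subr_eq0 -mevalB; apply/eqP/(ha d) => //; exact: rpredB.
Qed.

(** The residue field is [k]: the constant is the ratio of the values of the two forms at [P]. *)
Lemma local_ring_value P f :
  local_ring P f -> exists c : k, max_ideal P (f - c%:A).
Proof.
move=> [d [F [G [hF hG GP ->]]]]; have nG := form_value_neq0 hG GP.
exists (F.@[P] / G.@[P]), d, (F - (F.@[P] / G.@[P]) *: G), G; split=> //.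
- by apply: rpredB => //; exact: rpredZ.
- by rewrite mevalB mevalZ divfK // subrr.
by rewrite form_valueB form_valueZ mulrBl -scalerAl divff.
Qed.

Lemma local_ringV P f : local_ring P f -> ~ max_ideal P f -> local_ring P f^-1.
Proof.
move=> [d [F [G [hF hG GP ->]]]] h; exists d, G, F; split=> //.
  by apply/eqP => FP; apply: h; exists d, F, G.
by rewrite invf_div.
Qed.

End LocalRing.

(** * Pole orders measured by one uniformizer *)

Section Uniformizer.
Variables (k : closedFieldType) (C : proj_variety k).
Local Notation K := (function_field C).
Variables (P : point C) (u : K) (uP : uniformizer P u).
Implicit Types (f g : K).

Lemma uniformizer_neq0 : u != 0. Proof. by case: uP. Qed.
Lemma uniformizer_max : max_ideal P u. Proof. by case: uP. Qed.
Lemma uniformizer_local : local_ring P u.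
Proof. exact/max_ideal_local/uniformizer_max. Qed.

Lemma max_idealE f : max_ideal P f <-> local_ring P (f / u).
Proof.
have [u0 um ul] := uP; split=> [/ul //|h].
by rewrite -(divfK u0 f) mulrC; exact: max_idealMr.
Qed.

Lemma max_idealP (a : k) f g :
  max_ideal P f -> max_ideal P g -> max_ideal P (a *: f + g).
Proof.
move=> /max_idealE hf /max_idealE hg; apply/max_idealE.
by rewrite mulrDl -scalerAl; exact: local_ringP.
Qed.
Lemma max_idealD f g : max_ideal P f -> max_ideal P g -> max_ideal P (f + g).
Proof. by move=> hf hg; rewrite -[f]scale1r; exact: max_idealP. Qed.
Lemma max_ideal0 : max_ideal P 0.
Proof. by apply/max_idealE; rewrite mul0r; exact: local_ring0. Qed.
Lemma max_idealN f : max_ideal P f -> max_ideal P (- f).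
Proof.
move=> hf; rewrite -scaleN1r -[_ *: _]addr0; apply: max_idealP => //.
exact: max_ideal0.
Qed.

Lemma max_idealC (a : k) : max_ideal P (a%:A) -> a = 0.
Proof.
move=> h; apply/eqP/negP => /negP a0; apply: (@max_ideal_neq1 _ _ P).
rewrite -[1](scale1r) -(mulVf a0) -scalerA -[_ *: _]addr0.
by apply: max_idealP => //; exact: max_ideal0.
Qed.

(** The definition of [pole] quantifies over all uniformizers; one suffices because [t / u] and
    [u / t] are both regular, which handles both signs of [m]. *)
Lemma poleE (m : int) f : pole P m f <-> local_ring P (f * u ^ m).
Proof.
split=> [|h t tP]; first exact.
have [t0 tm tl] := tP; have [u0 um ul] := uP.
have -> : f * t ^ m = f * u ^ m * (t / u) ^ m.
  by rewrite -mulrA -expfzMl [u * _]mulrC divfK.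
apply: local_ringM => //; case: m {h} => m; first exact/local_ringX/ul.
by rewrite NegzE -exprnN -exprVn invf_div; exact/local_ringX/tl.
Qed.

Lemma pole0E f : pole P 0 f <-> local_ring P f.
Proof. by rewrite poleE expr0z mulr1. Qed.

Lemma poleV (m : nat) : pole P m (u ^- m).
Proof.
apply/poleE; rewrite -exprnP mulVf ?expf_neq0 ?uniformizer_neq0 //.
exact: local_ring1.
Qed.

(** Otherwise [1 / u] would be regular and [1] would lie in the maximal ideal. *)
Lemma pole_exact (m : nat) : ~ pole P m (u ^- m.+1).
Proof.
have u0 := uniformizer_neq0.
move=> /poleE; rewrite -exprnP exprSr invfM mulrAC mulVf ?expf_neq0 // => h.
by apply: (@max_ideal_neq1 _ _ P); apply/max_idealE.
Qed.

End Uniformizer.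

(** * Equality of classes in a subquotient *)

Section SubquotientClasses.
Variables (k : fieldType) (V : lmodType k) (M N : subspace V).

Lemma subquot_class_eq v w (Mv : M v) (Mw : M w) :
  subquot_class N Mv = subquot_class N Mw <-> N (v - w).
Proof. exact: quot_piP. Qed.

Lemma subquot_class_eq0 v (Mv : M v) : subquot_class N Mv = 0 <-> N v.
Proof.
split=> [|h]; rewrite -[X in _ = X](linear0 (quot_proj (inner_subspace M N))).
  by move=> /quot_piP; rewrite subr0.
by apply/quot_piP; rewrite subr0.
Qed.

End SubquotientClasses.

(** * Principal parts and the passage from H^1(O) to H^1(O(P)) *)

Section PrincipalParts.
Variables (k : closedFieldType) (C : proj_variety k).
Local Notation K := (function_field C).
Hypothesis C_smooth : smooth_curve C.
Implicit Types (P Q : point C) (f g : K) (E : divisor C).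

Lemma uniformizer_exists P : exists u, uniformizer P u.
Proof. by have [u [uP _]] := C_smooth P; exists u. Qed.

Lemma pole0_local P f : pole P 0 f <-> local_ring P f.
Proof. by have [u uP] := uniformizer_exists P; exact: pole0E uP f. Qed.

Lemma polar_part_gen_neq0 P u (uP : uniformizer P u) (m : nat) :
  subquot_class (pole P m) (poleV uP m.+1) != 0.
Proof. by apply/eqP => /subquot_class_eq0; exact: pole_exact. Qed.

(** The sum is represented by the sum of the one-point adeles, so its vanishing unfolds to
    [principal_mod]. *)
Lemma sum_principal_part_eq0 (I : finType) (A : pred I) (q : I -> point C)
    (f : I -> K) E :
  \sum_(i | A i) principal_part E (q i) (f i) = 0 <->
  exists h, forall Q, pole Q (E Q) (\sum_(i | A i) at_point (q i) (f i) Q - h).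
Proof.
pose a : subsp (@adeles k C) := \sum_(i | A i) to_subsp (at_point_adele (q i) (f i)).
have -> : \sum_(i | A i) principal_part E (q i) (f i)
    = subquot_class (principal_mod E) (subsp_mem a).
  rewrite -(linear_sum (quot_proj (inner_subspace _ (principal_mod E)))).
  by congr (quot_proj _ _); apply: val_inj.
have aE Q : subsp_val a Q = \sum_(i | A i) at_point (q i) (f i) Q.
  transitivity ((\sum_(i | A i) at_point (q i) (f i)) Q); last by rewrite fct_sumE.
  by congr (_ Q); exact: (raddf_sum val).
split=> [/subquot_class_eq0|] -[h hh]; last apply/subquot_class_eq0.
  by exists h => Q; rewrite -aE; exact: hh.
by exists h => Q; rewrite aE; exact: hh.
Qed.

Lemma xi_mapE P f (hf : pole P 1 f) :
  xi_map P (subquot_class (pole P 0) hf) = principal_part 0 P f.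
Proof. exact: subquot_liftE. Qed.

Lemma H1_twistE P Q f :
  H1_twist P (principal_part 0 Q f) = principal_part (div_point P) Q f.
Proof.
rewrite [LHS]subquot_mapE; apply/subquot_class_eq; rewrite subrr.
exact: subspace0.
Qed.

Lemma H1_mod_xi_twistE P y : H1_mod_xi_twist P (proj_mod_xi P y) = H1_twist P y.
Proof. exact: quot_liftE. Qed.

(** Exactness of T_P -> H^1(O) -> H^1(O(P)) in the middle: if [h] trivializes the adele [a] modulo
    O(P), then [a - h] is regular away from [P], so only its component at [P] matters, and that has
    at most a simple pole. *)
Lemma H1_twist_ker P y :
  H1_twist P y = 0 ->
  exists f, pole P 1 f /\ y = principal_part 0 P f.
Proof.
elim/subquotW: y => a ha; rewrite [H1_twist _ _]subquot_mapE => /subquot_class_eq0.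
move=> [h hh]; exists (a P - h); split.
  by have := hh P; rewrite div_pointP.
apply/subquot_class_eq; exists h => Q.
have -> : (a - at_point P (a P - h)) Q = a Q - at_point P (a P - h) Q by [].
have := hh Q; rewrite /div_point /at_point.
have [->|_] := eqVneq Q P; last by rewrite subr0.
by move=> _; rewrite subKr subrr; exact: subspace0.
Qed.

(** Injectivity is [H1_twist_ker]; for surjectivity, the same adele represents a class in both
    groups. *)
Lemma H1_mod_xi_twist_bij P : bijective (H1_mod_xi_twist P).
Proof.
apply: inj_surj_bijective => [x y /eqP|y].
  rewrite -subr_eq0 -linearB => /eqP; set z := x - y => zy.
  apply/eqP; rewrite -subr_eq0 -/z; apply/eqP; move: z zy; elim/quotW => z.
  move=> /(etrans (esym (H1_mod_xi_twistE P z))) /H1_twist_ker [f [hf ->]].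
  rewrite -[RHS](linear0 (proj_mod_xi P)); apply/quot_piP; rewrite subr0.
  by exists (subquot_class (pole P 0) hf); rewrite xi_mapE.
elim/subquotW: y => a ha.
exists (proj_mod_xi P (subquot_class (principal_mod 0) ha)).
rewrite H1_mod_xi_twistE [LHS]subquot_mapE; apply/subquot_class_eq.
by rewrite subrr; exact: subspace0.
Qed.

End PrincipalParts.

(** * The isomorphism from the sum of the tangent lines to H^1(O) *)

Section PointSum.
Variables (k : closedFieldType) (C : proj_variety k) (g : nat).
Local Notation K := (function_field C).
Variable p : 'I_g -> point C.
Hypotheses (C_smooth : smooth_curve C) (p_inj : injective p).
Implicit Types (P Q : point C) (f h : K) (A : pred 'I_g).

Lemma subquot_reprK (V : lmodType k) (M N : subspace V) (x : subquot M N) :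
  subquot_class N (subquot_reprP x) = x.
Proof.
by elim/subquotW: x => v Mv; apply/subquot_class_eq/subquot_repr_class.
Qed.

Lemma xi_map_repr P (s : tangent P) :
  xi_map P s = principal_part 0 P (subquot_repr s).
Proof. by rewrite -[in LHS](subquot_reprK s) xi_mapE. Qed.

Lemma sum_at_point_in A (f : 'I_g -> K) i :
  A i -> \sum_(j | A j) at_point (p j) (f j) (p i) = f i.
Proof.
move=> Ai; rewrite (bigD1 i) //= big1 ?addr0 => [|j /andP [_ ji]].
  by rewrite /at_point eqxx.
by rewrite /at_point (inj_eq p_inj) eq_sym (negbTE ji).
Qed.

Lemma sum_at_point_out A (f : 'I_g -> K) Q :
  (forall i, A i -> Q != p i) -> \sum_(j | A j) at_point (p j) (f j) Q = 0.
Proof.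
by move=> h; rewrite big1 // => j /h; rewrite /at_point => /negbTE ->.
Qed.

Lemma point_cases A Q : (exists2 i, A i & Q = p i) \/ (forall i, A i -> Q != p i).
Proof.
case: (pselect (exists2 i, A i & Q = p i)) => h; [by left | right => i Ai].
by apply/eqP => Qi; apply: h; exists i.
Qed.

(** As the points are distinct, at most one summand of the adele is nonzero at any given point. *)
Lemma sum_principal_part_points A (f : 'I_g -> K) E :
  \sum_(i | A i) principal_part E (p i) (f i) = 0 <->
  exists h, (forall i, A i -> pole (p i) (E (p i)) (f i - h)) /\
    forall Q, (forall i, A i -> Q != p i) -> pole Q (E Q) h.
Proof.
have poleN Q m x : pole Q m (- x) -> pole Q m x.
  by rewrite -[in X in _ -> X](opprK x) -[- - x]scaleN1r; exact: subspaceZ.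
split=> [/sum_principal_part_eq0|] -[h hh].
  exists h; split=> [i Ai|Q hQ]; first by rewrite -(sum_at_point_in f Ai).
  by apply: poleN; have := hh Q; rewrite sum_at_point_out // sub0r.
have [h1 h2] := hh; apply/sum_principal_part_eq0; exists h => Q.
have [[i Ai ->]|hQ] := point_cases A Q; first by rewrite sum_at_point_in //; exact: h1.
by rewrite sum_at_point_out // sub0r -scaleN1r; exact/subspaceZ/h2.
Qed.

Lemma div_points_in i : div_points p (p i) = 1.
Proof.
rewrite /div_points fct_sumE (bigD1 i) //= big1 ?addr0 => [|j ji].
  by rewrite /div_point eqxx.
by rewrite /div_point (inj_eq p_inj) eq_sym (negbTE ji).
Qed.

Lemma div_points_out Q : (forall i, Q != p i) -> div_points p Q = 0.
Proof.
move=> h; rewrite /div_points fct_sumE big1 // => j _.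
by rewrite /div_point (negbTE (h j)).
Qed.

Hypothesis h0D : has_dim (subsp (sections (div_points p))) 1.

(** The function [1] is a nonzero section, so it spans the one-dimensional space. *)
Lemma sections_points_const f : sections (div_points p) f -> exists a : k, f = a%:A.
Proof.
move=> hf; have h1 : sections (div_points p) 1.
  move=> Q; apply: (@pole_mono _ _ _ 0); last exact/(pole0_local C_smooth)/local_ring1.
  have [[i _ ->]|hQ] := point_cases predT Q; first by rewrite div_points_in.
  by rewrite div_points_out // => i; exact: hQ.
have [|a /(congr1 val) /= ->] := has_dim1_colinear (to_subsp hf) (y := to_subsp h1) h0D.
  by apply/eqP => /(congr1 val) /= /eqP; rewrite oner_eq0.
by exists a.
Qed.

Lemma sections_pointsP f : sections (div_points p) f <->
  (forall i, pole (p i) 1 f) /\ forall Q, (forall i, Q != p i) -> pole Q 0 f.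
Proof.
split=> [h|[h1 h2] Q].
  split=> [i|Q hQ]; first by have := h (p i); rewrite div_points_in.
  by have := h Q; rewrite div_points_out.
have [[i _ ->]|hQ] := point_cases predT Q; first by rewrite div_points_in; exact: h1.
have {}hQ i : Q != p i by exact: hQ.
by rewrite div_points_out //; exact: h2.
Qed.

(** A global [h] with the polar parts [s j] is a section of O(D), hence constant, so each [s j] has
    a regular representative. *)
Lemma tangent_sum_eq0 (s : forall j, tangent (p j)) :
  tangent_sum s = 0 -> forall j, s j = 0.
Proof.
rewrite /tangent_sum (eq_bigr _ (fun j _ => xi_map_repr (s j))).
move=> /(sum_principal_part_points predT) [h [h1 h2]] j.
have [|a ha] := sections_points_const (f := h).
  apply/sections_pointsP; split=> [i|Q hQ]; last by apply: h2 => i _.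
  have -> : h = (-1) *: (subquot_repr (s i) - h) + subquot_repr (s i).
    by rewrite scaleN1r opprB subrK.
  apply: subspaceP; last exact: subquot_reprP.
  by apply: pole_mono (h1 i isT).
rewrite -(subquot_reprK (s j)); apply/subquot_class_eq0.
rewrite -[subquot_repr _](subrK h); apply: subspaceD; first exact: h1.
by rewrite ha; apply/(pole0_local C_smooth)/local_ringC.
Qed.

Lemma tangent_sum_inj : injective (@tangent_sum k C g p).
Proof.
move=> s s' e; apply: functional_extensionality_dep => j; apply/eqP.
rewrite -subr_eq0; apply/eqP; move: j; apply: tangent_sum_eq0.
rewrite /tangent_sum (eq_bigr _ (fun j _ => linearB (xi_map (p j)) (s j) (s' j))).
by rewrite sumrB; apply/eqP; rewrite subr_eq0; apply/eqP.
Qed.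

Hypothesis C_genus : has_dim (H1 (0 : divisor C)) g.

(** The nonzero classes [tau j] of the inverses of uniformizers give an injective linear map from
    k^g to H^1(O), which has dimension [g]. *)
Lemma tangent_sum_surj y : exists s : forall j, tangent (p j), tangent_sum s = y.
Proof.
have [u uP] := choice (fun j => uniformizer_exists C_smooth (p j)).
pose tau j : tangent (p j) := subquot_class (pole (p j) 0) (poleV (uP j) 1).
pose s (v : 'rV[k]_g) j : tangent (p j) := v 0 j *: tau j.
pose F v := tangent_sum (s v).
have F_lin : linear F.
  move=> a v w; rewrite /F /tangent_sum scaler_sumr -big_split /=.
  apply: eq_bigr => j _; apply: etrans (linearP (xi_map (p j)) a _ _).
  by rewrite /s !mxE scalerDl scalerA.
pose hF := GRing.isLinear.Build k _ _ *:%R F F_lin.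
pose Fl : {linear 'rV[k]_g -> H1 (0 : divisor C)} := HB.pack F hF.
have F_inj : injective Fl.
  move=> v w /tangent_sum_inj e; apply/rowP => j.
  have /eqP := congr1 (fun s => s j) e; rewrite /s -subr_eq0 -scalerBl.
  by rewrite scaler_eq0 (negbTE (polar_part_gen_neq0 (uP j) 0)) orbF subr_eq0 => /eqP.
by have [v <-] := has_dim_inj_surj C_genus F_inj y; exists (s v).
Qed.

Lemma tangent_sum_bij : bijective (@tangent_sum k C g p).
Proof. exact: inj_surj_bijective tangent_sum_inj tangent_sum_surj. Qed.

End PointSum.

(** * Isolating one term of a finite sum *)

Section IsolatedTerm.
Variables (V : zmodType) (I : finType) (i : I) (a : I -> V).

Lemma sum_single : (forall j, j != i -> a j = 0) -> \sum_j a j = a i.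
Proof. by move=> a0; rewrite (bigD1 i) //= big1 ?addr0. Qed.

Lemma sum_split_sig : \sum_j a j = a i + \sum_(j : {j | j != i}) a (val j).
Proof.
rewrite (bigD1 i) //=; congr (_ + _).
exact: (big_sub [pred j | j != i] a).
Qed.

Lemma sum_eq0_sig : \sum_j a j = 0 -> a i = \sum_(j : {j | j != i}) - a (val j).
Proof. by rewrite sum_split_sig sumrN => /eqP; rewrite addr_eq0 => /eqP. Qed.

End IsolatedTerm.

Lemma comp_linearN (k : fieldType) (T U V : lmodType k) (f : {linear U -> V})
    (h : {linear T -> U}) x : f (h (- x)) = - f (h x).
Proof. by rewrite !linearN. Qed.

(** * Polar parts of order two and the components of [delta'] *)

Section TangentMap.
Variables (k : closedFieldType) (C : proj_variety k) (g : nat).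
Local Notation K := (function_field C).
Variable p : 'I_g -> point C.
Hypotheses (C_smooth : smooth_curve C) (p_inj : injective p).
Hypothesis h0D : has_dim (subsp (sections (div_points p))) 1.
Hypothesis C_genus : has_dim (H1 (0 : divisor C)) g.
Variable i : 'I_g.

Lemma inverseK (A B : lmodType k) (f : A -> B) : bijective f -> cancel f (inverse f).
Proof.
move=> [h fK _] x; apply: (can_inj fK).
by apply: (@xgetPex _ 0 [set z | f z = f x]%classic); exists x.
Qed.

Lemma tangent_sum_split (s : forall j, tangent (p j)) :
  tangent_sum s = xi_map (p i) (s i)
    + \sum_(j : {j | j != i}) xi_map (p (val j)) (s (val j)).
Proof.
exact: (sum_split_sig i (fun j => xi_map (p j) (s j))).
Qed.

Lemma proj_mod_xi0 P (y : H1 (0 : divisor C)) :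
  proj_mod_xi P y = 0 <-> exists s, y = xi_map P s.
Proof.
split=> h.
  suff: image_subspace (xi_map P) y by [].
  rewrite -[y]subr0; apply/quot_piP.
  by rewrite -[LHS]/(proj_mod_xi P y) h -[LHS](linear0 (proj_mod_xi P)).
by rewrite -[RHS](linear0 (proj_mod_xi P)); apply/quot_piP; rewrite subr0.
Qed.

Lemma tangent_sum_modE (s : forall j : {j | j != i}, tangent (p (val j))) :
  tangent_sum_mod s = proj_mod_xi (p i) (\sum_j xi_map (p (val j)) (s j)).
Proof. by rewrite linear_sum. Qed.

(** Both halves come from [tangent_sum]: for surjectivity the term at [i] is dropped, since it dies
    in the quotient. *)
Lemma tangent_sum_mod_bij : bijective (@tangent_sum_mod k C g p i).
Proof.
apply: inj_surj_bijective => [s s'|].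
  rewrite !tangent_sum_modE => /eqP; rewrite -subr_eq0 -linearB => /eqP.
  move=> /proj_mod_xi0 [r er].
  (* The two sums differ by [xi_map (p i) r]; completing one family by [0] and the other by [r] at
     [i] gives equal values of [tangent_sum]. *)
  have [t [ti ts]] := dep_extension (T := fun j => tangent (p j)) 0 s.
  have [t' [ti' ts']] := dep_extension (T := fun j => tangent (p j)) r s'.
  have tt' : t = t'.
    apply: (tangent_sum_inj C_smooth p_inj h0D); rewrite !tangent_sum_split.
    rewrite ti ti' linear0 add0r -er (eq_bigr _ (fun j _ => congr1 _ (ts j))).
    by rewrite [X in _ = _ + X](eq_bigr _ (fun j _ => congr1 _ (ts' j))) subrK.
  by apply: functional_extensionality_dep => j; rewrite -ts -ts' tt'.
elim/quotW => y; have [s <-] := tangent_sum_surj C_smooth p_inj h0D C_genus y.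
exists (fun j => s (val j)); rewrite tangent_sum_modE tangent_sum_split.
rewrite -[RHS]/(proj_mod_xi (p i) _) linearD.
rewrite (_ : proj_mod_xi (p i) (xi_map (p i) (s i)) = 0) ?add0r //.
by apply/proj_mod_xi0; exists (s i).
Qed.

Lemma sections_points_addP h : sections (div_points p + div_point (p i)) h <->
  [/\ pole (p i) 2 h, forall j, j != i -> pole (p j) 1 h
    & forall Q, (forall j, Q != p j) -> pole Q 0 h].
Proof.
split=> [hh|[h2 h1 h0] Q].
  split=> [|j /negbTE ji|Q hQ].
  - by have := hh (p i); rewrite div_points_val // eqxx.
  - by have := hh (p j); rewrite div_points_val // ji.
  have := hh Q; rewrite -[(_ + _) Q]/(div_points p Q + div_point (p i) Q).
  by rewrite div_points_out // /div_point (negbTE (hQ i)).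
have [[j _ ->]|hQ] := point_cases p predT Q.
  rewrite div_points_val //; have [->|/h1 //] := eqVneq j i; exact: h2.
have {}hQ j : Q != p j by exact: hQ.
rewrite -[(_ + _) Q]/(div_points p Q + div_point (p i) Q).
by rewrite div_points_out // /div_point (negbTE (hQ i)); exact: h0.
Qed.

(** This is the surjectivity of [polar_i], from that of [tangent_sum]: in H^1(O) the class of [f0]
    at [p i] can be cancelled by simple poles at the points [p j]. *)
Lemma polar_i_lift f0 : pole (p i) 2 f0 ->
  exists h, sections (div_points p + div_point (p i)) h /\ pole (p i) 1 (f0 - h).
Proof.
move=> hf0; have [s hs] := tangent_sum_surj C_smooth p_inj h0D C_genus
  (principal_part 0 (p i) f0).
(* These principal parts sum to zero, so they come from a global [h], which agrees with [f0] at
   [p i] up to a simple pole. *)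
pose F j : K := (if j == i then f0 else 0) - subquot_repr (s j).
have : \sum_(j < g) principal_part 0 (p j) (F j) = 0.
  have FE j : principal_part 0 (p j) (F j) =
      principal_part 0 (p j) (if j == i then f0 else 0) - xi_map (p j) (s j).
    by rewrite xi_map_repr; exact: linearB.
  rewrite (eq_bigr _ (fun j _ => FE j)) sumrB.
  have -> : \sum_(j < g) xi_map (p j) (s j) = principal_part 0 (p i) f0 := hs.
  pose a j := principal_part 0 (p j) (if j == i then f0 else 0).
  have ai : a i = principal_part 0 (p i) f0 by rewrite /a eqxx.
  rewrite -[X in X - _]/(\sum_j a j) (sum_single (i := i)) => [|j /negbTE ji].
    by rewrite ai; exact: subrr.
  by rewrite /a ji; exact: (raddf0 (principal_part 0 (p j))).
move=> /(sum_principal_part_points p_inj predT) [h [h1 h2]].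
have f0h : pole (p i) 1 (f0 - h).
  have -> : f0 - h = (F i - h) + subquot_repr (s i).
    by rewrite /F eqxx addrAC subrK.
  apply: subspaceD; last exact: subquot_reprP.
  by apply: pole_mono (h1 i isT).
exists h; split=> //; apply/sections_points_addP; split=> [|j ji|Q hQ].
- have -> : h = (-1) *: (f0 - h) + f0 by rewrite scaleN1r opprB subrK.
  by apply: subspaceP => //; apply: pole_mono f0h.
- have -> : h = (-1) *: ((F j - h) + subquot_repr (s j)).
    by rewrite /F (negbTE ji) sub0r addrAC addNr add0r scaleN1r opprK.
  apply: subspaceZ; apply: subspaceD; last exact: subquot_reprP.
  by apply: pole_mono (h1 j isT).
by apply: h2 => j _.
Qed.

Lemma polar_iE h (hh : sections (div_points p + div_point (p i)) h)
    (h2 : pole (p i) 2 h) :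
  polar_i p_inj i (subquot_class (sections 0) hh) = subquot_class (pole (p i) 1) h2.
Proof.
rewrite [LHS]subquot_mapE; apply/subquot_class_eq; rewrite subrr.
exact: subspace0.
Qed.

Lemma polar_ijE j (ji : j != i) h (hh : sections (div_points p + div_point (p i)) h)
    (h1 : pole (p j) 1 h) :
  polar_ij p_inj ji (subquot_class (sections 0) hh) = subquot_class (pole (p j) 0) h1.
Proof.
rewrite [LHS]subquot_mapE; apply/subquot_class_eq; rewrite subrr.
exact: subspace0.
Qed.

(** A section in the kernel has at most a simple pole at [p i], so it lies in H^0(O(D)) and is
    constant. *)
Lemma polar_i_bij : bijective (polar_i p_inj i).
Proof.
apply: inj_surj_bijective => [x y /eqP|x].
  rewrite -subr_eq0 -linearB => /eqP; set z := x - y => zy.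
  apply/eqP; rewrite -subr_eq0 -/z; apply/eqP; move: z zy; elim/subquotW => h hh.
  have [h2 h1 h0] := (sections_points_addP h).1 hh.
  rewrite (polar_iE hh h2) => /subquot_class_eq0 h3; apply/subquot_class_eq0.
  have [|a ->] := sections_points_const C_smooth p_inj h0D (f := h).
    by apply/(sections_pointsP p_inj); split=> // j; have [->|/h1] := eqVneq j i.
  by move=> Q; apply/(pole0_local C_smooth)/local_ringC.
elim/subquotW: x => f0 hf0; have [h [hh f0h]] := polar_i_lift hf0.
have [h2 _ _] := (sections_points_addP h).1 hh.
exists (subquot_class (sections 0) hh); rewrite (polar_iE hh h2).
apply/subquot_class_eq; rewrite -opprB -scaleN1r; exact: subspaceZ.
Qed.

Lemma H1_mod_xi_twist_sum (P : point C) (I : finType) (y : I -> H1 (0 : divisor C)) :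
  H1_mod_xi_twist P (proj_mod_xi P (\sum_j y j)) = \sum_j H1_twist P (y j).
Proof. by rewrite H1_mod_xi_twistE; exact: (raddf_sum (H1_twist P)). Qed.

(** As [H1_mod_xi_twist] is bijective, the chosen preimage defining [delta'] is a genuine one, and
    identities for [delta'] can be checked in H^1(O(P)). *)
Lemma delta'_twist (P : point C) (s t : tangent P) :
  H1_mod_xi_twist P (delta' s t)
  = principal_part (div_point P) P (subquot_repr s * subquot_repr t).
Proof.
have [h hK h'K] := H1_mod_xi_twist_bij P.
rewrite /delta'; set y := connecting _ _ _.
have -> : H1_mod_xi_twist P (inverse (H1_mod_xi_twist P) y) = y.
  by apply: (@xgetPex _ 0 [set z | H1_mod_xi_twist P z = y]%classic); exists (h y).
exact: subquot_liftE.
Qed.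

Lemma delta'E (s t : tangent (p i)) :
  delta' s t = tangent_sum_mod
    (fun j : {j | j != i} => - alpha p_inj (valP j) (tangent_mul s t)).
Proof.
apply: (bij_inj (H1_mod_xi_twist_bij (p i))); rewrite delta'_twist.
set f0 := _ * _; have hf0 : pole (p i) 2 f0.
  exact: poleM (subquot_reprP s) (subquot_reprP t).
have [h [hh f0h]] := polar_i_lift hf0.
have [h2 h1 h0] := (sections_points_addP h).1 hh.
have st : tangent_mul s t = polar_i p_inj i (subquot_class (sections 0) hh).
  by rewrite (polar_iE hh h2); apply/subquot_class_eq.
have [G [G0 Gi Gj]] : exists G : 'I_g -> H1 (div_point (p i)),
    [/\ \sum_j G j = 0, G i = principal_part (div_point (p i)) (p i) f0
      & forall j, j != i -> G j = principal_part (div_point (p i)) (p j) h].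
  (* In H^1(O(p_i)) a simple pole at [p i] is zero, so [f0] may replace [h] at [p i]; the diagonal
     adele of [h] then shows that the sum vanishes. *)
  pose F j := if j == i then f0 else h.
  exists (fun j => principal_part (div_point (p i)) (p j) (F j)); split.
  - apply/(sum_principal_part_points p_inj predT F); exists h; split=> [j _|Q hQ].
      rewrite /F; have [->|ji] := eqVneq j i; first by rewrite div_pointP.
      by rewrite subrr; exact: subspace0.
    have {}hQ j : Q != p j by exact: hQ.
    by rewrite /div_point (negbTE (hQ i)); exact: h0.
  - by rewrite /F eqxx.
  by move=> j /negbTE ji; rewrite /F ji.
(* Solving the vanishing sum for its term at [i] produces the minus sign. *)
rewrite -Gi (sum_eq0_sig i G0) tangent_sum_modE H1_mod_xi_twist_sum.
apply: eq_bigr => j _; rewrite (Gj _ (valP j)).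
have aE : H1_twist (p i) (xi_map (p (val j)) (alpha p_inj (valP j) (tangent_mul s t)))
    = principal_part (div_point (p i)) (p (val j)) h.
  rewrite /alpha st (inverseK polar_i_bij).
  by rewrite (polar_ijE _ hh (h1 _ (valP j))) xi_mapE H1_twistE.
rewrite -aE.
exact: (esym (comp_linearN (H1_twist (p i)) (xi_map (p (val j))) _)).
Qed.

End TangentMap.

(** * Determinants modulo the maximal ideal *)

Section LocalDeterminant.
Variables (k : closedFieldType) (C : proj_variety k).
Local Notation K := (function_field C).
Variables (P : point C) (u : K) (uP : uniformizer P u).

(** Regularity of both sides is included so that the relation is stable under products. *)
Definition local_cong (x y : K) :=
  [/\ local_ring P x, local_ring P y & max_ideal P (x - y)].

Lemma local_cong_refl x : local_ring P x -> local_cong x x.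
Proof. by split=> //; rewrite subrr; exact: max_ideal0 uP. Qed.

Lemma local_congD x y x' y' :
  local_cong x y -> local_cong x' y' -> local_cong (x + x') (y + y').
Proof.
move=> [hx hy h] [hx' hy' h']; split; try exact: local_ringD.
by rewrite opprD addrACA; exact: (max_idealD uP).
Qed.

Lemma local_congM x y x' y' :
  local_cong x y -> local_cong x' y' -> local_cong (x * x') (y * y').
Proof.
move=> [hx hy h] [hx' hy' h']; split; try exact: local_ringM.
have -> : x * x' - y * y' = (x - y) * x' + (x' - y') * y.
  by ring.
by apply: (max_idealD uP); exact: max_idealMr.
Qed.

Lemma local_cong_det m (A B : 'M[K]_m) :
  (forall i j, local_cong (A i j) (B i j)) -> local_cong (\det A) (\det B).
Proof.
move=> AB; have l1 := local_ring1 P.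
apply: (big_ind2 local_cong); first exact/local_cong_refl/local_ring0.
  by move=> *; exact: local_congD.
move=> s _; apply: local_congM.
  exact/local_cong_refl/local_ringX/local_ringN.
apply: (big_ind2 local_cong) => //; first exact: local_cong_refl.
by move=> *; exact: local_congM.
Qed.

Lemma local_adj m (A : 'M[K]_m) : (forall i j, local_ring P (A i j)) ->
  forall i j, local_ring P ((\adj A) i j).
Proof.
move=> hA i j; rewrite mxE; apply: local_ringM.
  exact/local_ringX/local_ringN/local_ring1.
(* The congruence of a minor with itself carries its regularity. *)
suff [] : local_cong (\det (row' j (col' i A))) (\det (row' j (col' i A))) by [].
by apply: local_cong_det => i' j'; rewrite !mxE; exact: local_cong_refl.
Qed.

End LocalDeterminant.

(** * Differentials, values and residues at a point *)

Section Derivation.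
Variables (k : closedFieldType) (C : proj_variety k).
Local Notation K := (function_field C).
Local Notation n := (proj_dim C).
Variables (Om : lmodType K) (d : K -> Om) (hd : is_derivation d).

Lemma derM f g : d (f * g) = f *: d g + g *: d f.
Proof. by case: hd. Qed.

Lemma der0 : d 0 = 0.
Proof. by have := derM 0 0; rewrite mul0r !scale0r addr0. Qed.

Lemma derZ (a : k) f : d (a *: f) = a%:A *: d f.
Proof. by have [h _] := hd; rewrite -[a *: f]addr0 h der0 addr0. Qed.

Lemma derD f g : d (f + g) = d f + d g.
Proof. by have [h _] := hd; rewrite -[f]scale1r h !scale1r. Qed.

Lemma derC (a : k) : d (a%:A) = 0.
Proof.
have d1 : d 1 = 0.
  have /eqP := derM 1 1.
  by rewrite mulr1 !scale1r addrC -subr_eq subrr eq_sym => /eqP.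
by rewrite derZ d1 scaler0.
Qed.

Lemma derV f : f != 0 -> d f^-1 = - (f^-1 * f^-1) *: d f.
Proof.
move=> f0; have /eqP := derM f f^-1; rewrite divff // -(scale1r 1) derC eq_sym addr_eq0.
move=> /eqP /(congr1 (fun w => f^-1 *: w)).
by rewrite scalerA mulVf // scale1r scalerN scalerA scaleNr.
Qed.

Variable P : point C.

Section Span.
Variables (m : nat) (xi : 'I_m -> K).

Definition local_span (w : Om) :=
  exists c : 'I_m -> K, (forall j, local_ring P (c j)) /\
    w = \sum_j c j *: d (xi j).

Lemma local_spanD v w : local_span v -> local_span w -> local_span (v + w).
Proof.
move=> [c [hc ->]] [c' [hc' ->]]; exists (fun j => c j + c' j); split.
  by move=> j; exact: local_ringD.
by rewrite -big_split /=; apply: eq_bigr => j _; rewrite scalerDl.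
Qed.

Lemma local_spanZ f w : local_ring P f -> local_span w -> local_span (f *: w).
Proof.
move=> hf [c [hc ->]]; exists (fun j => f * c j); split.
  by move=> j; exact: local_ringM.
by rewrite scaler_sumr; apply: eq_bigr => j _; rewrite scalerA.
Qed.

Lemma local_span0 : local_span 0.
Proof.
exists (fun => 0); split=> [_|]; first exact: local_ring0.
by rewrite big1 // => j _; rewrite scale0r.
Qed.

Lemma local_span_gen j : local_span (d (xi j)).
Proof.
exists (fun l => (l == j)%:R); split=> [l|].
  by case: eqP => _; [exact: local_ring1 | exact: local_ring0].
rewrite (bigD1 j) //= eqxx scale1r big1 ?addr0 // => l /negbTE ->.
by rewrite scale0r.
Qed.

(** By the Leibniz rule this is a ring closed under inverses of units; regular functions are reached
    as fractions of polynomials in the [xi j]. *)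
Definition span_ring (f : K) := local_ring P f /\ local_span (d f).

Lemma span_ringC (a : k) : span_ring (a%:A).
Proof. by split; [exact: local_ringC | rewrite derC; exact: local_span0]. Qed.

Lemma span_ringD f g : span_ring f -> span_ring g -> span_ring (f + g).
Proof.
move=> [hf sf] [hg sg]; split; first exact: local_ringD.
by rewrite derD; exact: local_spanD.
Qed.

Lemma span_ringM f g : span_ring f -> span_ring g -> span_ring (f * g).
Proof.
move=> [hf sf] [hg sg]; split; first exact: local_ringM.
by rewrite derM; apply: local_spanD; exact: local_spanZ.
Qed.

Lemma span_ringX f e : span_ring f -> span_ring (f ^+ e).
Proof.
move=> hf; elim: e => [|e IH]; last by rewrite exprS; exact: span_ringM.
by rewrite expr0 -(scale1r 1); exact: span_ringC.
Qed.

Lemma span_ringV f : f != 0 -> ~ max_ideal P f -> span_ring f -> span_ring f^-1.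
Proof.
move=> f0 fm [hf sf]; have hV := local_ringV hf fm; split=> //.
by rewrite derV //; apply: local_spanZ => //; exact/local_ringN/local_ringM.
Qed.

Lemma span_ring_mmap (F : {mpoly k[m]}) :
  (forall j, local_ring P (xi j)) -> span_ring (mmap (in_alg K) xi F).
Proof.
move=> hxi; have s1 : span_ring 1 by rewrite -(scale1r 1); exact: span_ringC.
have s0 : span_ring 0 by rewrite -(scale0r 1); exact: span_ringC.
apply: (big_ind span_ring) => // [|mo _]; first exact: span_ringD.
apply: span_ringM; first exact: span_ringC.
apply: (big_ind span_ring) => // [|j _]; first exact: span_ringM.
by apply: span_ringX; split=> //; exact: local_span_gen.
Qed.

End Span.

(** All monomials of [F] have degree [e], so dividing the coordinates by [c0] costs each the same
    factor. *)
Lemma form_value_dehomog (c0 : K) e (F : {mpoly k[n.+1]}) :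
  c0 != 0 -> F \is e.-homog ->
  form_value F = c0 ^+ e * mmap (in_alg K) (fun j => coord j / c0) F.
Proof.
move=> c00 /dhomogP hF; rewrite /form_value /mmap mulr_sumr.
apply: eq_big_seq => mo /hF moe; have <- : mdeg mo = e := moe.
rewrite mulrCA; congr (_ * _).
rewrite /mmap1 mdegE -prodrXr -big_split /=; apply: eq_bigr => j _.
by rewrite -exprMn mulrC divfK.
Qed.

(** [xi] are the affine coordinates around [P]. *)
Lemma local_ring_span : exists xi : 'I_n.+1 -> K,
  (forall j, local_ring P (xi j)) /\
  forall f, local_ring P f -> local_span xi (d f).
Proof.
have [i0 Pi0] : exists i0, point_coord P i0 = 1.
  by case: (P) => a /= /asboolP [[i0 [ai0 _]] _]; exists i0.
have hX j : ('X_j : {mpoly k[n.+1]}) \is 1.-homog.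
    by rewrite dhomogX; apply/eqP; exact: mdeg1.
have X0 : ('X_i0 : {mpoly k[n.+1]}).@[P] != 0 by rewrite mevalXU Pi0 oner_neq0.
have XE j : form_value 'X_j = coord j :> K by rewrite /form_value mmapX mmap1U.
have c0 : coord i0 != 0 :> K by rewrite -XE; exact: form_value_neq0 (hX i0) X0.
pose xi j : K := coord j / coord i0.
have hxi j : local_ring P (xi j).
  by exists 1%N, 'X_j, 'X_i0; split=> //; rewrite !XE.
exists xi; split=> // f [e [F [G [hF hG GP ->]]]].
rewrite (form_value_dehomog c0 hF) (form_value_dehomog c0 hG) -/xi.
rewrite -mulf_div divff ?expf_neq0 // mul1r.
suff [] : span_ring xi (mmap (in_alg K) xi F / mmap (in_alg K) xi G) by [].
apply: span_ringM; first exact: span_ring_mmap.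
have G0 := form_value_neq0 hG GP.
have Gxi0 : mmap (in_alg K) xi G != 0.
  by apply: contra_neq G0 => h; rewrite (form_value_dehomog c0 hG) -/xi h mulr0.
apply: span_ringV => //; last exact: span_ring_mmap.
(* The inverse of the dehomogenized [G] is the regular function [X_i0 ^ e / G], so [G] cannot become
   a non-unit. *)
move=> hm; apply: (@max_ideal_neq1 _ _ P); rewrite -(divff Gxi0).
apply: max_idealMr => //; exists e, ('X_i0 ^+ e), G; split=> //.
  by rewrite -[e in e.-homog]mul1n; exact: dhomogMn.
rewrite (form_value_dehomog c0 hG) -/xi /form_value rmorphXn /= -/(form_value _) XE.
by rewrite invfM mulrA divff ?expf_neq0 // mul1r.
Qed.

Variables (u : K) (uP : uniformizer P u).

(** Nakayama's lemma: writing [xi_j = v + z u] with [v] constant, [d xi_j] is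
    [z du] plus [u dz], so the vector of the [d xi_j] solves a linear system
    with matrix [M] congruent to the identity modulo the maximal ideal. *)
Lemma local_der f : local_ring P f -> exists2 q, local_ring P q & d f = q *: d u.
Proof.
have u0 := uniformizer_neq0 uP.
have [xi [hxi hspan]] := local_ring_span.
have step j : exists zc : K * ('I_n.+1 -> K), [/\ local_ring P zc.1,
    forall l, local_ring P (zc.2 l)
  & d (xi j) = zc.1 *: d u + u *: \sum_l zc.2 l *: d (xi l)].
  have [v /(max_idealE uP) hz] := local_ring_value (hxi j).
  have [c [hc dz]] := hspan _ hz; exists ((xi j - v%:A) / u, c); split=> //=.
  by rewrite -dz -derM divfK // derD -scaleNr derC addr0.
have [zc hzc] := choice step.
pose M : 'M[K]_n.+1 := \matrix_(j, l) ((j == l)%:R - u * (zc j).2 l).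
have Mcong j l : local_cong P (M j l) ((1%:M : 'M[K]_n.+1) j l).
  have hb : local_ring P ((j == l)%:R : K).
    by case: eqP => _; [exact: local_ring1 | exact: local_ring0].
  have hm : max_ideal P (- (u * (zc j).2 l)).
    apply: (max_idealN uP); apply: max_idealMr; first exact: uniformizer_max.
    by have [] := hzc j.
  rewrite !mxE; split=> //; last by rewrite addrAC subrr add0r.
  by apply: local_ringD => //; exact: max_ideal_local.
have Mdxi j : \sum_l M j l *: d (xi l) = (zc j).1 *: d u.
  have [_ _ e] := hzc j.
  under eq_bigr do rewrite mxE scalerBl -scalerA.
  rewrite sumrB -scaler_sumr (bigD1 j) //= eqxx scale1r big1 => [|l /negbTE].
    by rewrite addr0 {1}e addrK.
  by rewrite eq_sym => ->; rewrite scale0r.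
have [hdet _] := local_cong_det uP Mcong; rewrite det1 => hdet1.
(* The determinant is congruent to [1], hence a unit of the local ring. *)
have detm : ~ max_ideal P (\det M).
  move=> h; apply: (@max_ideal_neq1 _ _ P).
  rewrite -(subKr (\det M) 1); apply: (max_idealD uP) => //.
  exact: (max_idealN uP hdet1).
have det0 : \det M != 0 by apply/eqP => h; apply: detm; rewrite h; exact: max_ideal0 uP.
have dxi j : exists2 q, local_ring P q & d (xi j) = q *: d u.
  (* Cramer's rule: the system is multiplied by the adjugate, whose entries are regular. *)
  exists ((\det M)^-1 * \sum_i (\adj M) j i * (zc i).1).
    apply: local_ringM; first exact: local_ringV.
    apply: (big_ind (local_ring P)); first exact: local_ring0.
      by move=> x y; exact: local_ringD.
    move=> i _; apply: local_ringM; last by have [] := hzc i.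
    by apply: (local_adj uP) => a b; have [] := Mcong a b.
  rewrite -scalerA scaler_suml.
  under eq_bigr do rewrite -scalerA -Mdxi scaler_sumr.
  rewrite exchange_big /=.
  have adjE l : \sum_i (\adj M) j i *: (M i l *: d (xi l))
      = (\det M *+ (j == l)) *: d (xi l).
    have /matrixP /(_ j l) := mul_adj_mx M; rewrite !mxE => <-.
    by rewrite scaler_suml; apply: eq_bigr => i _; rewrite scalerA.
  rewrite (eq_bigr _ (fun l _ => adjE l)) (bigD1 j) //= eqxx mulr1n big1 => [|l /negbTE].
    by rewrite addr0 scalerA mulVf // scale1r.
  by rewrite eq_sym => ->; rewrite mulr0n scale0r.
move=> /hspan [c [hc ->]].
apply: (big_ind (fun w => exists2 q, local_ring P q & w = q *: d u)).
- by exists 0; [exact: local_ring0 | rewrite scale0r].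
- move=> _ _ [q hq ->] [q' hq' ->]; exists (q + q'); first exact: local_ringD.
  by rewrite scalerDl.
move=> j _; have [q hq ->] := dxi j; exists (c j * q); first exact: local_ringM.
by rewrite scalerA.
Qed.

(** By [local_der] each [d g] with [g] regular is a regular multiple of [d u]. *)
Lemma omega_stalkP E eta : omega_stalk d E P eta ->
  exists2 q, pole P (E P) q & eta = q *: d u.
Proof.
move=> [r [hr ->]]; elim: r hr => [|x r IH] hr.
  by exists 0; [exact: subspace0 | rewrite big_nil scale0r].
have [|q hq e] := IH; first by move=> y yr; apply: hr; rewrite inE yr orbT.
have [h1 /local_der [z hz dz]] := hr x (mem_head _ _).
exists (x.1 * z + q); last by rewrite big_cons e dz scalerA scalerDl.
apply: subspaceD => //; rewrite -[E P]addr0; apply: poleM => //.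
exact/(pole0E uP).
Qed.

Hypothesis du0 : d u != 0.

(** Relates the coefficient of [d u] to the cotangent class: the two agree modulo the maximal ideal
    after division by [u]. *)
Lemma omega_value_sum (r : seq (K * K)) :
  (forall x, x \in r -> local_ring P x.1 /\ max_ideal P x.2) ->
  exists q, [/\ local_ring P q, \sum_(x <- r) x.1 *: d x.2 = q *: d u
    & max_ideal P ((\sum_(x <- r) x.1 * x.2) / u - q)].
Proof.
have u_neq0 := uniformizer_neq0 uP.
elim: r => [|x r IH] hr.
  exists 0; rewrite !big_nil scale0r mul0r subr0.
  by split=> //; [exact: local_ring0 | exact: max_ideal0 uP].
have [|q [hq e hm]] := IH; first by move=> y yr; apply: hr; rewrite inE yr orbT.
have [h1 /(max_idealE uP) h2] := hr x (mem_head _ _).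
have [z hz dz] := local_der h2.
(* Leibniz applied to [x.2 = (x.2 / u) * u], with [d (x.2 / u) = z *: d u]; the extra term [u * z]
   vanishes at [P]. *)
exists (x.1 * (x.2 / u + u * z) + q); split.
- apply: local_ringD => //; apply: local_ringM => //; apply: local_ringD => //.
  by apply: local_ringM => //; exact: uniformizer_local uP.
- rewrite big_cons e -{1}(divfK u_neq0 x.2) derM dz scalerA -scalerDl scalerA.
  by rewrite scalerDl.
rewrite big_cons mulrDl opprD addrACA; apply: (max_idealD uP) => //.
rewrite -mulrA -mulrBr opprD addrA subrr sub0r mulrN; apply: (max_idealN uP).
rewrite mulrCA; apply: max_idealMr; first exact: uniformizer_max.
exact: local_ringM.
Qed.

(** The value does not depend on the presentation of the differential: since [d u] is nonzero its
    coefficient is unique, and two constants congruent modulo the maximal ideal are equal. *)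
Lemma omega_value_eq (t : tangent P) q (c : k) : local_ring P q ->
  max_ideal P (q * u * subquot_repr t - c%:A) -> omega_value d t (q *: d u) = c.
Proof.
have u_neq0 := uniformizer_neq0 uP.
move=> hq hc; apply: xget_unique => [|c' [r [hr e hm]]].
  exists [:: (q, u)]; rewrite !big_seq1; split=> // x; rewrite inE => /eqP ->.
  by split=> //; exact: uniformizer_max.
have [q' [hq' e' hm']] := omega_value_sum hr.
have qq' : q = q'.
  apply/eqP; rewrite -subr_eq0; have /eqP := etrans e e'.
  by rewrite -subr_eq0 -scalerBl scaler_eq0 (negbTE du0) orbF.
apply/eqP; rewrite -subr_eq0; apply/eqP/(max_idealC uP); rewrite scalerBl.
set s := subquot_repr t in hc hm; set S := \sum_(x <- r) _ in hm hm'.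
(* The last term lies in the maximal ideal because [s] has at most a simple pole, so [u * s] is
   regular. *)
have -> : c'%:A - c%:A
    = (q * u * s - c%:A) + - (S * s - c'%:A) + (S / u - q) * (u * s) :> K.
  by field.
apply: (max_idealD uP); first by apply: (max_idealD uP) => //; exact: (max_idealN uP hm).
rewrite qq'; apply: max_idealMr => //.
have := subquot_reprP t; rewrite -/s => /(poleE uP).
by rewrite expr1z mulrC.
Qed.

Lemma residue_eq f q (c : k) : max_ideal P (q * u * f - c%:A) ->
  is_residue d P (f *: (q *: d u)) c.
Proof.
have u_neq0 := uniformizer_neq0 uP.
(* The polar sum has the single term [c / u]; the remainder [f * q - c / u] equals
   [(q * u * f - c) / u]. *)
move=> /(max_idealE uP) h; exists u, 0%N, (fun=> c), (f * q - c *: u^-1); split=> //.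
  move: h; rewrite mulrBl -scalerAl mul1r mulrAC mulrAC.
  by rewrite -mulrA [q * _]mulrC; congr (local_ring P (_ - _)); field.
by rewrite big_ord1 expr1 addrC subrK scalerA.
Qed.

End Derivation.

(** * Comparison with the canonical morphism under Serre duality *)

Section SerreDuality.
Variables (k : closedFieldType) (C : proj_variety k).
Local Notation K := (function_field C).
Variables (Om : lmodType K) (d : K -> Om) (hd : is_derivation d).
Variable S : H1 (0 : divisor C) -> {linear H0_omega d -> k^o}.
Hypothesis S_serre : serre_duality S.
Variables (P : point C) (u : K) (uP : uniformizer P u).

(** If [d u] were zero, H^0(omega) and its dual would be trivial, and H^1(O) with them. *)
Lemma der_uniformizer_neq0 (y : H1 (0 : divisor C)) : y != 0 -> d u != 0.
Proof.
apply: contra_neq => du0.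
have eta0 (eta : H0_omega d) : eta = 0.
  apply: val_inj; have [q _ e] := omega_stalkP hd uP (subsp_mem eta P).
  by apply: etrans e _; rewrite du0 scaler0.
have [_ bij _] := S_serre; have [z [_ zz]] := bij (S 0).
have h x : z = x by apply: zz => eta; rewrite (eta0 eta) !linear0.
by rewrite -(h y) -(h 0).
Qed.

Hypothesis du0 : d u != 0.

Lemma serre_principal_part f q (eta : H0_omega d) (c : k) :
  H0_omega_val eta = q *: d u -> max_ideal P (q * u * f - c%:A) ->
  S (principal_part 0 P f) eta = c.
Proof.
have [_ _ res] := S_serre; move=> e hc; apply: res.
by rewrite e; exact: residue_eq.
Qed.

Lemma local_tangent_repr (t : tangent P) : local_ring P (u * subquot_repr t).
Proof. by have /(poleE uP) := subquot_reprP t; rewrite expr1z mulrC. Qed.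

(** With [eta = q *: d u], both sides are the value at [P] of [q * u] times a representative of
    [t]. *)
Lemma serre_xi (t : tangent P) (eta : H0_omega d) : S (xi_map P t) eta = ev t eta.
Proof.
have [q /(pole0E uP) hq e] := omega_stalkP hd uP (subsp_mem eta P).
have ht := local_tangent_repr t.
have [c hc] := local_ring_value (local_ringM hq ht).
rewrite mulrA in hc.
rewrite xi_map_repr (serre_principal_part e hc); apply/esym.
rewrite /ev /H0_omega_val e; exact: (omega_value_eq hd uP du0).
Qed.

Lemma serre_delta' (s t : tangent P) (y : H1 (0 : divisor C)) (eta : H0_omega d) :
  proj_mod_xi P y = delta' s t ->
  omega_sections d (- div_point P) (subsp_val eta) ->
  S y eta = canonical_tangent_map d s t (H0_omega_val eta).
Proof.
move=> ys heta; have [q hq e] := omega_stalkP hd uP (heta P).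
have {}hq : pole P (-1) q.
  by move: hq; rewrite -[(- div_point P) P]/(- div_point P P) div_pointP.
set a := subquot_repr s; set b := subquot_repr t.
(* In H^1(O(P)) the class [y] becomes that of [a * b] at [P], so in H^1(O) they differ by a simple
   principal part. *)
have [f [hf yf]] : exists f,
    pole P 1 f /\ y - principal_part 0 P (a * b) = principal_part 0 P f.
  apply: H1_twist_ker; rewrite linearB; apply/eqP; rewrite subr_eq0; apply/eqP.
  by rewrite -H1_mod_xi_twistE ys delta'_twist H1_twistE.
have {yf} -> : y = principal_part 0 P (a * b + f).
  apply/eqP; move/eqP: yf; rewrite subr_eq => /eqP ->.
  by rewrite addrC; apply/eqP; exact: esym (linearD _ _ _).
have hqa : local_ring P (q * a).
  by apply/(pole0E uP); exact: poleM hq (subquot_reprP s).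
have hqf : local_ring P (q * f) by apply/(pole0E uP); exact: poleM hq hf.
have [c hc] := local_ring_value (local_ringM hqa (local_tangent_repr t)).
rewrite mulrA in hc.
rewrite (serre_principal_part (c := c) e).
  rewrite /canonical_tangent_map /H0_omega_val e scalerA [_ * q]mulrC; apply/esym.
  exact: (omega_value_eq hd uP du0).
(* The ambiguity [f] does not contribute: [eta] vanishes at [P], so [q * f] is regular and
   [u * (q * f)] is zero at [P]. *)
have -> : q * u * (a * b + f) - c%:A = (q * a * u * b - c%:A) + u * (q * f) :> K.
  by ring.
apply: (max_idealD uP) => //.
exact: max_idealMr (uniformizer_max uP) hqf.
Qed.

End SerreDuality.

Theorem proposition3p3p1 (k : closedFieldType) (C : proj_variety k) (g : nat)
    (p : 'I_g -> point C)
    (C_smooth : smooth_curve C)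
    (g_ge2 : (2 <= g)%N)
    (C_genus : has_dim (H1 (0 : divisor C)) g)
    (p_inj : injective p)
    (h0D : has_dim (subsp (sections (div_points p))) 1) :
  bijective (@tangent_sum k C g p) /\
  forall i : 'I_g,
  [/\ bijective (polar_i p_inj i),
      bijective (H1_mod_xi_twist (p i)),
      bijective (@tangent_sum_mod k C g p i),
      forall s t : tangent (p i),
        delta' s t
        = tangent_sum_mod
            (fun j : {j | j != i} => - alpha p_inj (valP j) (tangent_mul s t))
    & forall (Om : lmodType (function_field C)) (d : function_field C -> Om)
        (S : H1 (0 : divisor C) -> {linear H0_omega d -> k^o}),
        is_kaehler d -> serre_duality S ->
        (forall (t : tangent (p i)) (eta : H0_omega d),
           S (xi_map (p i) t) eta = ev t eta) /\
        (forall (s t : tangent (p i)) (y : H1 (0 : divisor C)),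
           proj_mod_xi (p i) y = delta' s t ->
           forall eta : H0_omega d,
             omega_sections d (- div_point (p i)) (subsp_val eta) ->
             S y eta = canonical_tangent_map d s t (H0_omega_val eta))].
Proof.
split=> [|i]; first exact: tangent_sum_bij.
split.
- exact: polar_i_bij.
- exact: H1_mod_xi_twist_bij.
- exact: tangent_sum_mod_bij.
- by move=> s t; exact: delta'E.
move=> Om d S [hd _] hS; have [u uP] := uniformizer_exists C_smooth (p i).
(* The index [i] witnesses [g > 0]: the all-ones vector has a nonzero entry at [i]. *)
have [y y0] : exists y : H1 (0 : divisor C), y != 0.
  have [b b_bij] := C_genus; exists (b (const_mx 1)); apply/eqP => h.
  have /rowP /(_ i) := bij_inj b_bij (etrans h (esym (linear0 b))).
  by rewrite !mxE => /eqP; rewrite oner_eq0.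
have du0 := der_uniformizer_neq0 hd hS uP y0.
split=> [t eta|s t y' ys eta he]; first exact: (serre_xi hd hS uP du0).
exact: (serre_delta' hd hS uP du0 ys he).
Qed.
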